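(* Let $X$ and $Y$ be two compact nontrivial (i.e. positive-dimensional) almost-complex manifolds. Then the product $X\times Y$, with the product almost complex structure, does not admit any almost-Hermitian metric with negative bisectional curvature.
   Context: Manifolds are smooth and connected. An almost-Hermitian metric on an almost-complex manifold $(M,J)$ of real dimension $2N$ is a Riemannian metric $g$ with $g(JV,JW)=g(V,W)$. Extend $g,J$ complex linearly to $T^{\mathbb{C}}M=T'M\oplus T''M$ (the $\sqrt{-1}$ and $-\sqrt{-1}$ eigenbundles of $J$). $\|Z\|^2=g(Z,\overline Z)$ for complex vectors $Z$. Repeated indices are summed. Let $\{e_1,\dots,e_N\}$ be a local unitary frame of $T'M$ (so $g(e_i,\overline{e_j})=\delta_{ij}$) with dual coframe $\{\theta^i\}$. A connection $\nabla$ with $\nabla J=\nabla g=0$ has connection forms $\nabla e_i=\theta_i^j e_j$, torsion forms $\Theta^i$ defined by $d\theta^i=-\theta^i_j\wedge\theta^j+\Theta^i$, and curvature forms $\Omega^i_j$ defined by $d\theta^i_j=-\theta^i_k\wedge\theta^k_j+\Omega^i_j$. The canonical connection is the unique such connection for which the $(1,1)$ part of $\Theta$ vanishes. For the canonical connection write $(\Omega_i^j)^{(1,1)}=R^j_{ik\overline\ell}\,\theta^k\wedge\overline{\theta^\ell}$; the bisectional curvature, for nonzero $V,W\in T'M$ at the same point, is $$B(V,W)=\frac{R^j_{ik\overline\ell}V^i\overline{V^j}W^k\overline{W^\ell}}{\|V\|^2\|W\|^2}.$$ It is negative if $B(V,W)<0$ for all such $V,W$. *)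

(* Defs.v *)
From HB Require Import structures.
From mathcomp Require Import all_boot all_order all_algebra.
From mathcomp Require Import complex.
From mathcomp Require Import all_classical all_reals all_analysis.

Set Implicit Arguments.
Unset Strict Implicit.
Unset Printing Implicit Defensive.

Import Order.TTheory GRing.Theory Num.Theory.
Import numFieldNormedType.Exports.

Local Open Scope classical_set_scope.
Local Open Scope ring_scope.

(* Vectors are row vectors throughout: a linear map acts by [v *m A], a bilinear
   form by [v *m g *m w^T], and [jacobian] follows the same convention.
   Tensor fields are given by their components in the charts of an atlas, as
   functions of the coordinates, together with the usual transformation laws. *)

Section Smooth.
Context {R : realType} {V W : normedModType R}.

Fixpoint Ck_on (k : nat) (U : set V) (f : V -> W) : Prop :=
  match k with
  | 0 => forall x, U x -> {for x, continuous f}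
  | k'.+1 => (forall x, U x -> differentiable f x) /\
             (forall v : V, Ck_on k' U ('D_v f))
  end.

Definition smooth_on (U : set V) (f : V -> W) : Prop := forall k, Ck_on k U f.

End Smooth.

Section Manifolds.
Context {R : realType}.

(* [chart_map] and [chart_inv] are only meaningful on [chart_dom], [chart_img] *)
Record chart (n : nat) (T : Type) := Chart {
  chart_dom : set T;
  chart_img : set 'rV[R]_n;
  chart_map : T -> 'rV[R]_n;
  chart_inv : 'rV[R]_n -> T }.

Definition is_chart n (T : topologicalType) (c : chart n T) : Prop :=
  [/\ open (chart_dom c) /\ open (chart_img c),
      (forall p, chart_dom c p -> chart_img c (chart_map c p)) /\
      (forall x, chart_img c x -> chart_dom c (chart_inv c x)),
      (forall p, chart_dom c p -> chart_inv c (chart_map c p) = p) /\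
      (forall x, chart_img c x -> chart_map c (chart_inv c x) = x),
      forall p, chart_dom c p -> {for p, continuous (chart_map c)} &
      forall x, chart_img c x -> {for x, continuous (chart_inv c)}].

Record charted_space (n : nat) := ChartedSpace {
  space :> topologicalType;
  chart_index : Type;
  atlas : chart_index -> chart n space }.

Section Atlas.
Context {n : nat} (M : charted_space n).
Implicit Types c d : chart_index M.

Definition cimg c : set 'rV[R]_n := chart_img (atlas c).

Definition overlap c d : set 'rV[R]_n :=
  [set x | cimg c x /\ chart_dom (atlas d) (chart_inv (atlas c) x)].

Definition transition c d (x : 'rV[R]_n) : 'rV[R]_n :=
  chart_map (atlas d) (chart_inv (atlas c) x).

Definition tjac c d (x : 'rV[R]_n) : 'M[R]_n := 'J (transition c d) x.

(* smooth, connected (in particular nonempty) manifold of dimension [n] *)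
Definition smooth_manifold : Prop :=
  [/\ hausdorff_space M /\ @second_countable M,
      [set: M] !=set0 /\ connected [set: M],
      forall c, is_chart (atlas c),
      forall p : M, exists c, chart_dom (atlas c) p &
      forall c d, smooth_on (overlap c d) (transition c d)].

Definition mx_field := chart_index M -> 'rV[R]_n -> 'M[R]_n.

(* In particular [n] is even. *)
Definition almost_complex (J : mx_field) : Prop :=
  [/\ forall c, smooth_on (cimg c) (J c),
      forall c x, cimg c x -> J c x *m J c x = - 1%:M &
      forall c d x, overlap c d x ->
        J c x *m tjac c d x = tjac c d x *m J d (transition c d x)].

Definition riemannian_metric (g : mx_field) : Prop :=
  [/\ forall c, smooth_on (cimg c) (g c),
      forall c x, cimg c x -> (g c x)^T = g c x,
      forall c x (v : 'rV[R]_n), cimg c x -> v != 0 ->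
        0 < (v *m g c x *m v^T) 0 0 &
      forall c d x, overlap c d x ->
        g c x = tjac c d x *m g d (transition c d x) *m (tjac c d x)^T].

Definition almost_hermitian_metric (J g : mx_field) : Prop :=
  riemannian_metric g /\
  forall c x, cimg c x -> J c x *m g c x *m (J c x)^T = g c x.

(* Christoffel symbols: the covariant derivative of the [b]-th coordinate field
   along the [a]-th one is the [b]-th row of [D c a x]. *)
Definition christoffel :=
  chart_index M -> 'I_n -> 'rV[R]_n -> 'M[R]_n.

Definition basis_vec (a : 'I_n) : 'rV[R]_n := delta_mx 0 a.

(* The last clause says that [D_v V + V *m \sum_a v_a D_a] transforms as a
   vector under change of chart. *)
Definition is_connection (D : christoffel) : Prop :=
  (forall c a, smooth_on (cimg c) (D c a)) /\
  forall c d x a, overlap c d x ->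
    'D_(basis_vec a) (tjac c d) x
      + tjac c d x *m (\sum_b tjac c d x a b *: D d b (transition c d x))
    = D c a x *m tjac c d x.

Definition parallel_acs (D : christoffel) (J : mx_field) : Prop :=
  forall c x a, cimg c x ->
    'D_(basis_vec a) (J c) x + J c x *m D c a x - D c a x *m J c x = 0.

Definition parallel_metric (D : christoffel) (g : mx_field) : Prop :=
  forall c x a, cimg c x ->
    'D_(basis_vec a) (g c) x - D c a x *m g c x - g c x *m (D c a x)^T = 0.

End Atlas.
End Manifolds.

Section ComplexFields.
Context {R : realType}.
Local Notation C := R[i].

Definition cplx_mx p q (A : 'M[R]_(p, q)) : 'M[C]_(p, q) :=
  map_mx (real_complex R) A.
Definition re_mx p q (A : 'M[C]_(p, q)) : 'M[R]_(p, q) :=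
  map_mx (@complex.Re R) A.
Definition im_mx p q (A : 'M[C]_(p, q)) : 'M[R]_(p, q) :=
  map_mx (@complex.Im R) A.
Definition conj_mx p q (A : 'M[C]_(p, q)) : 'M[C]_(p, q) := map_mx conjc A.

Definition smooth_cplx_on n (U : set 'rV[R]_n) (F : 'rV[R]_n -> 'rV[C]_n) :=
  smooth_on U (fun x => re_mx (F x)) /\ smooth_on U (fun x => im_mx (F x)).

Definition pderiv n (a : 'I_n) (F : 'rV[R]_n -> 'rV[C]_n) (x : 'rV[R]_n) :
    'rV[C]_n :=
  cplx_mx ('D_(basis_vec a) (fun y => re_mx (F y)) x)
  + 'i%C *: cplx_mx ('D_(basis_vec a) (fun y => im_mx (F y)) x).

(* A complex 1-form is the row of its components, a complex 2-form the
   skew-symmetric matrix of its values on pairs of coordinate vectors. *)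
Definition ev1 n (al v : 'rV[C]_n) : C := (v *m al^T) 0 0.
Definition ev2 n (om : 'M[C]_n) (v w : 'rV[C]_n) : C := (v *m om *m w^T) 0 0.

Definition ext_d n (al : 'rV[R]_n -> 'rV[C]_n) (x : 'rV[R]_n) : 'M[C]_n :=
  \matrix_(a, b) (pderiv a al x 0 b - pderiv b al x 0 a).

Definition wedge n (al be : 'rV[C]_n) : 'M[C]_n := al^T *m be - be^T *m al.

(* membership in T' at a point where the almost complex structure is [J] *)
Definition type10 n (J : 'M[R]_n) (v : 'rV[C]_n) : Prop :=
  v *m cplx_mx J = 'i%C *: v.

Definition proj10 n (J : 'M[R]_n) : 'M[C]_n :=
  2^-1 *: (1%:M - 'i%C *: cplx_mx J).
Definition proj01 n (J : 'M[R]_n) : 'M[C]_n :=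
  2^-1 *: (1%:M + 'i%C *: cplx_mx J).

Definition part11 n (J : 'M[R]_n) (om : 'M[C]_n) : 'M[C]_n :=
  proj10 J *m om *m (proj01 J)^T + proj01 J *m om *m (proj10 J)^T.

Definition metricC n (g : 'M[R]_n) (v w : 'rV[C]_n) : C :=
  ev2 (cplx_mx g) v w.
Definition normsq n (g : 'M[R]_n) (v : 'rV[C]_n) : C :=
  metricC g v (conj_mx v).

End ComplexFields.

Section Canonical.
Context {R : realType} {n : nat} (M : @charted_space R n).
Local Notation C := R[i].
Local Notation N := (n./2).

Record frame_data := FrameData {
  frame : 'I_N -> 'rV[R]_n -> 'rV[C]_n;
  coframe : 'I_N -> 'rV[R]_n -> 'rV[C]_n;
  (* [conn_form i j] is the form with lower index [i] and upper index [j] *)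
  conn_form : 'I_N -> 'I_N -> 'rV[R]_n -> 'rV[C]_n }.

(* complex linear extension of the connection, along a complex vector [v] *)
Definition nablaC (D : christoffel M) (c : chart_index M)
    (v : 'rV[C]_n) (Z : 'rV[R]_n -> 'rV[C]_n) (x : 'rV[R]_n) : 'rV[C]_n :=
  \sum_(a < n) v 0 a *: (pderiv a Z x + Z x *m cplx_mx (D c a x)).

(* a local unitary frame of T' on [O] (in the coordinates of the chart [c]),
   with its dual coframe and the connection forms of [D] *)
Definition unitary_frame_on (J g : mx_field M) (D : christoffel M)
    (c : chart_index M) (O : set 'rV[R]_n) (F : frame_data) : Prop :=
  [/\ open O /\ O `<=` cimg c,
      (forall i, smooth_cplx_on O (frame F i)) /\
      (forall i, smooth_cplx_on O (coframe F i)) /\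
      (forall i j, smooth_cplx_on O (conn_form F i j)),
      forall x, O x ->
        (forall i, type10 (J c x) (frame F i x)) /\
        (forall i j, metricC (g c x) (frame F i x) (conj_mx (frame F j x))
                     = (i == j)%:R),
      forall x i j, O x ->
        ev1 (coframe F i x) (frame F j x) = (i == j)%:R /\
        ev1 (coframe F i x) (conj_mx (frame F j x)) = 0 &
      forall x i v, O x ->
        nablaC D c v (frame F i) x
        = \sum_j ev1 (conn_form F i j x) v *: frame F j x].

Definition torsion_form (F : frame_data) (i : 'I_N) (x : 'rV[R]_n) : 'M[C]_n :=
  ext_d (coframe F i) x + \sum_j wedge (conn_form F j i x) (coframe F j x).

(* lower index [i], upper index [j] *)
Definition curvature_form (F : frame_data) (i j : 'I_N) (x : 'rV[R]_n) :
    'M[C]_n :=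
  ext_d (conn_form F i j) x
  + \sum_k wedge (conn_form F k j x) (conn_form F i k x).

Definition canonical_connection (J g : mx_field M) (D : christoffel M) : Prop :=
  [/\ is_connection D, parallel_acs D J, parallel_metric D g &
      forall c O F, unitary_frame_on J g D c O F ->
        forall x i, O x -> part11 (J c x) (torsion_form F i x) = 0].

(* coefficient of [theta^k /\ conj theta^l] in the (1,1) part of the curvature *)
Definition curv_coef (J : mx_field M) (c : chart_index M) (F : frame_data)
    (x : 'rV[R]_n) (i j k l : 'I_N) : C :=
  ev2 (part11 (J c x) (curvature_form F i j x))
      (frame F k x) (conj_mx (frame F l x)).

Definition bisectional (J g : mx_field M) (c : chart_index M) (F : frame_data)
    (x : 'rV[R]_n) (V W : 'rV[C]_n) : C :=
  let Vc i := ev1 (coframe F i x) V in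
  let Wc i := ev1 (coframe F i x) W in
  (\sum_i \sum_j \sum_k \sum_l
     curv_coef J c F x i j k l * Vc i * conjc (Vc j) * Wc k * conjc (Wc l))
  / (normsq (g c x) V * normsq (g c x) W).

(* The value of [bisectional] does not depend on the unitary frame around [x],
   nor on the chart. The order on [R[i]] is the partial one: [z < 0] means that
   [z] is real and negative. *)
Definition negative_bisectional (J g : mx_field M) : Prop :=
  exists2 D : christoffel M, canonical_connection J g D &
  forall c x, cimg c x ->
    exists O F, [/\ O x, unitary_frame_on J g D c O F &
      forall V W : 'rV[C]_n, type10 (J c x) V -> type10 (J c x) W ->
        V != 0 -> W != 0 -> bisectional J g c F x V W < 0].

End Canonical.

Section Product.
Context {R : realType} {m n : nat}.
Variables (X : @charted_space R m) (Y : @charted_space R n).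

Definition prod_chart (c : chart_index X * chart_index Y) :
    @chart R (m + n) (X * Y)%type :=
  Chart
    [set p | chart_dom (atlas c.1) p.1 /\ chart_dom (atlas c.2) p.2]
    [set x | chart_img (atlas c.1) (lsubmx x) /\
             chart_img (atlas c.2) (rsubmx x)]
    (fun p => row_mx (chart_map (atlas c.1) p.1) (chart_map (atlas c.2) p.2))
    (fun x => (chart_inv (atlas c.1) (lsubmx x),
               chart_inv (atlas c.2) (rsubmx x))).

Definition prod_space : @charted_space R (m + n) :=
  @ChartedSpace R (m + n) (X * Y)%type (chart_index X * chart_index Y)%type
    prod_chart.

Definition prod_acs (JX : mx_field X) (JY : mx_field Y) : mx_field prod_space :=
  fun c x => block_mx (JX c.1 (lsubmx x)) 0 0 (JY c.2 (rsubmx x)).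

End Product.

(* Main.v *)
Require Import Defs.
From HB Require Import structures.
From mathcomp Require Import all_boot all_order all_algebra.
From mathcomp Require Import complex ring.
From mathcomp Require Import all_classical all_reals all_analysis.

Set Implicit Arguments.
Unset Strict Implicit.
Unset Printing Implicit Defensive.

Import Order.TTheory GRing.Theory Num.Theory.
Import numFieldNormedType.Exports.

Local Open Scope classical_set_scope.
Local Open Scope ring_scope.

(** The proof is a maximum principle on a slice [{x0} x Y] of the product.

    Fix a point [x0] of [X] and a nonzero vector [V] of type (1,0) tangent to [X]
    at [x0]. It may be regarded as a section of [T'(X x Y)] over the whole slice
    [{x0} x Y], and its square norm [|V|^2] for the given metric is a function on
    the compact manifold [Y], which attains a maximum ([slice_norm_attains_max]).

    Around the point of the maximum, extend [V] to a (1,0)-field [fieldX] coming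
    from [X], and let [W] be a (1,0)-field [fieldY] coming from [Y]. Then [V]
    commutes with the conjugate of [W] ([bracket_fieldX_fieldY]), so the torsion of
    this pair is the difference of the two covariant derivatives of one field along
    the other. These have types (0,1) and (1,0), because the connection preserves
    types; since the (1,1) part of the torsion vanishes, so do both. In particular
    [V] is holomorphic along [Y]: its covariant derivative along [conj W] vanishes
    ([torsion_hol]).

    For such a section, commuting covariant derivatives gives at a critical point
    of [|V|^2] on the slice the Bochner formula ([bochner])
      [W (conj W) |V|^2 = |nabla_W V|^2 - R (V, conj V, W, conj W)].
    The bracket of [W] and [conj W] does not vanish in general, but it is tangent to
    [Y], and its contribution is a derivative of [|V|^2] along [Y] up to terms
    killed by holomorphy; so it disappears at a critical point. If the bisectional
    curvature were negative, the right-hand side would be positive. At the maximum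
    the real part of the left-hand side is the Hessian of [|V|^2] evaluated on two
    real vectors tangent to [Y], hence nonpositive ([levi_nonpos]). This is a
    contradiction.

    All computations are done in the components of a unitary frame, where the
    connection forms are skew-Hermitian ([conn_skew]) and [|V|^2] is the sum of the
    squared moduli of the components of [V] ([normsq_frame]). *)

(** * Complex numbers, complex matrices and forms *)

Section ComplexMatrices.
Context {R : realType}.
Local Notation C := R[i].

Lemma ReD (a b : C) : complex.Re (a + b) = complex.Re a + complex.Re b.
Proof. by case: a; case: b. Qed.

Lemma ImD (a b : C) : complex.Im (a + b) = complex.Im a + complex.Im b.
Proof. by case: a; case: b. Qed.

Lemma ReM (a b : C) : complex.Re (a * b) =
  complex.Re a * complex.Re b - complex.Im a * complex.Im b.
Proof. by case: a; case: b. Qed.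

Lemma ImM (a b : C) : complex.Im (a * b) =
  complex.Re a * complex.Im b + complex.Im a * complex.Re b.
Proof. by case: a; case: b. Qed.

Lemma Im_sum (I : finType) (G : I -> C) :
  complex.Im (\sum_i G i) = \sum_i complex.Im (G i).
Proof. by elim/big_rec2: _ => // i p q _ <-; rewrite ImD. Qed.

Lemma Im_mul_conj (a : C) : complex.Im (a * conjc a) = 0.
Proof. by case: a => a b /=; rewrite mulrN mulrC addNr. Qed.

Lemma mul_conj_ge0 (a : C) : 0 <= a * conjc a.
Proof. by rewrite -sqr_normc. Qed.

Lemma lt0_of_div_lt0 (r a b : C) : 0 <= a -> 0 <= b -> r / (a * b) < 0 -> r < 0.
Proof.
move=> a0 b0; have : 0 <= a * b by exact: mulr_ge0.
rewrite le_eqVlt => /orP[/eqP <-|ab0]; first by rewrite invr0 mulr0 ltxx.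
by rewrite pmulr_llt0 ?invr_gt0.
Qed.

Lemma Re_sub_conj_gt0 (a r : C) : 0 <= a -> r < 0 -> 0 < complex.Re (a - conjc r).
Proof.
case: a => a1 a2; case: r => r1 r2; rewrite lecE ltcE /=.
move=> /andP[_ a10] /andP[_ r10]; rewrite subr_gt0.
exact: lt_le_trans r10 a10.
Qed.

Lemma mulii : ('i * 'i)%C = -1 :> C.
Proof. by rewrite -expr2 sqr_i. Qed.

Lemma conj_i : conjc ('i%C) = - 'i%C :> C.
Proof. by apply/eqP; rewrite eq_complex /= oppr0 !eqxx. Qed.

Lemma conj_Ni : conjc (- 'i%C) = 'i%C :> C.
Proof. by rewrite -conj_i conjcK. Qed.

Lemma half2 : (2^-1 : C) *+ 2 = 1.
Proof. by rewrite -[LHS]mulr_natr mulVf // pnatr_eq0. Qed.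

Lemma cplx_mxM p q r (A : 'M[R]_(p, q)) (B : 'M[R]_(q, r)) :
  cplx_mx (A *m B) = cplx_mx A *m cplx_mx B.
Proof. exact: map_mxM. Qed.

Lemma conj_mxK p q (A : 'M[C]_(p, q)) : conj_mx (conj_mx A) = A.
Proof. by apply/matrixP => i j; rewrite !mxE conjcK. Qed.

Lemma conj_mxM p q r (A : 'M[C]_(p, q)) (B : 'M[C]_(q, r)) :
  conj_mx (A *m B) = conj_mx A *m conj_mx B.
Proof. exact: map_mxM. Qed.

Lemma conj_mxD p q (A B : 'M[C]_(p, q)) :
  conj_mx (A + B) = conj_mx A + conj_mx B.
Proof. exact: map_mxD. Qed.

Lemma conj_mxZ p q (a : C) (A : 'M[C]_(p, q)) :
  conj_mx (a *: A) = conjc a *: conj_mx A.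
Proof. exact: map_mxZ. Qed.

Lemma conj_mx_sum p q (I : Type) (r : seq I) (F : I -> 'M[C]_(p, q)) :
  conj_mx (\sum_(i <- r) F i) = \sum_(i <- r) conj_mx (F i).
Proof. exact: raddf_sum. Qed.

Lemma conj_cplx_mx p q (A : 'M[R]_(p, q)) : conj_mx (cplx_mx A) = cplx_mx A.
Proof. by apply/matrixP => i j; rewrite !mxE /= oppr0. Qed.

Lemma cplx_reim p q (A : 'M[C]_(p, q)) :
  A = cplx_mx (re_mx A) + 'i%C *: cplx_mx (im_mx A).
Proof. by apply/matrixP => i j; rewrite !mxE; case: (A i j) => a b; simpc. Qed.

Lemma re_mx_reim p q (A B : 'M[R]_(p, q)) :
  re_mx (cplx_mx A + 'i%C *: cplx_mx B) = A.
Proof. by apply/matrixP => i j; rewrite !mxE /= mul0r mul1r subr0 addr0. Qed.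

Lemma re_mx_lsub p q (z : 'rV[C]_(p + q)) : lsubmx (re_mx z) = re_mx (lsubmx z).
Proof. by apply/matrixP => i j; rewrite !mxE. Qed.

Lemma ev1E n (al v : 'rV[C]_n) : ev1 al v = \sum_a v 0 a * al 0 a.
Proof. by rewrite /ev1 mxE; apply: eq_bigr => a _; rewrite mxE. Qed.

Lemma ev1D n (al v w : 'rV[C]_n) : ev1 al (v + w) = ev1 al v + ev1 al w.
Proof. by rewrite /ev1 mulmxDl mxE. Qed.

Lemma ev2E n (om : 'M[C]_n) (v w : 'rV[C]_n) :
  ev2 om v w = \sum_a \sum_b v 0 a * w 0 b * om a b.
Proof.
rewrite /ev2 mxE exchange_big; apply: eq_bigr => b _ /=.
rewrite !mxE mulr_suml; apply: eq_bigr => a _; by rewrite mulrAC.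
Qed.

Lemma ev2Dl n (om : 'M[C]_n) v v' w : ev2 om (v + v') w = ev2 om v w + ev2 om v' w.
Proof. by rewrite /ev2 !mulmxDl mxE. Qed.

Lemma ev2Dr n (om : 'M[C]_n) v w w' : ev2 om v (w + w') = ev2 om v w + ev2 om v w'.
Proof. by rewrite /ev2 raddfD mulmxDr mxE. Qed.

Lemma ev2Dm n (om om' : 'M[C]_n) v w : ev2 (om + om') v w = ev2 om v w + ev2 om' v w.
Proof. by rewrite /ev2 mulmxDr mulmxDl mxE. Qed.

Lemma ev2_suml n (om : 'M[C]_n) (I : Type) (r : seq I) (c : I -> C)
    (F : I -> 'rV[C]_n) w :
  ev2 om (\sum_(k <- r) c k *: F k) w = \sum_(k <- r) c k * ev2 om (F k) w.
Proof.
rewrite /ev2 !mulmx_suml summxE; apply: eq_bigr => k _.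
by rewrite -!scalemxAl mxE.
Qed.

Lemma ev2_sumr n (om : 'M[C]_n) (I : Type) (r : seq I) (c : I -> C)
    (F : I -> 'rV[C]_n) v :
  ev2 om v (\sum_(k <- r) c k *: F k) = \sum_(k <- r) c k * ev2 om v (F k).
Proof.
rewrite /ev2 linear_sum mulmx_sumr summxE; apply: eq_bigr => k _.
by rewrite linearZ -scalemxAr mxE.
Qed.

Lemma ev2_wedge n (al be v w : 'rV[C]_n) :
  ev2 (wedge al be) v w = ev1 al v * ev1 be w - ev1 be v * ev1 al w.
Proof.
rewrite ev2E !ev1E !mulr_suml -sumrB; apply: eq_bigr => a _.
rewrite !mulr_sumr -sumrB; apply: eq_bigr => b _.
by rewrite /wedge !mxE !big_ord1 !mxE; ring.
Qed.

End ComplexMatrices.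

(** * Types of complex vectors and unitary frames at a point *)

Section FrameAlgebra.
Context {R : realType}.
Local Notation C := R[i].

Definition type01 n (J : 'M[R]_n) (v : 'rV[C]_n) : Prop :=
  v *m cplx_mx J = - 'i%C *: v.

Lemma type10_conj n (J : 'M[R]_n) v : type10 J v -> type01 J (conj_mx v).
Proof.
move=> tv; rewrite /type01 -(conj_cplx_mx J) -conj_mxM tv conj_mxZ.
by rewrite conj_i.
Qed.

Lemma type01_conj n (J : 'M[R]_n) v : type01 J v -> type10 J (conj_mx v).
Proof.
move=> tv; rewrite /type10 -(conj_cplx_mx J) -conj_mxM tv conj_mxZ.
by rewrite conj_Ni.
Qed.

Lemma type10_01_eq0 n (J : 'M[R]_n) (v : 'rV[C]_n) : type10 J v -> type01 J v -> v = 0.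
Proof.
move=> t1 t2; move: t1; rewrite /type10 t2 => /eqP.
rewrite eq_sym scaleNr -addr_eq0 -mulr2n -scaler_nat scalerA scaler_eq0.
rewrite mulf_eq0 pnatr_eq0 /= => /orP[|/eqP//].
by rewrite eq_complex /= oner_eq0 andbF.
Qed.

Lemma proj10_id n (J : 'M[R]_n) v : type10 J v -> v *m proj10 J = v.
Proof.
move=> tv; rewrite /proj10 -scalemxAr mulmxBr mulmx1 -scalemxAr tv scalerA mulii.
by rewrite scaleN1r opprK -mulr2n -scalerMnr scalerMnl half2 scale1r.
Qed.

Lemma proj01_id n (J : 'M[R]_n) v : type01 J v -> v *m proj01 J = v.
Proof.
move=> tv; rewrite /proj01 -scalemxAr mulmxDr mulmx1 -scalemxAr tv scalerA.
by rewrite mulrN mulii opprK scale1r -mulr2n -scalerMnr scalerMnl half2 scale1r.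
Qed.

Lemma proj01_0 n (J : 'M[R]_n) v : type10 J v -> v *m proj01 J = 0.
Proof.
move=> tv; rewrite /proj01 -scalemxAr mulmxDr mulmx1 -scalemxAr tv scalerA mulii.
by rewrite scaleN1r subrr scaler0.
Qed.

Lemma ev2_part11 n (J : 'M[R]_n) (om : 'M[C]_n) (v w : 'rV[C]_n) :
  type10 J v -> type01 J w -> ev2 (part11 J om) v w = ev2 om v w.
Proof.
move=> tv tw; rewrite /ev2 /part11 mulmxDr !mulmxA proj10_id // proj01_0 //.
by rewrite !mul0mx addr0 -mulmxA -trmx_mul proj01_id.
Qed.

Lemma type_split n (J : 'M[R]_n) (v : 'rV[C]_n) : J *m J = - 1%:M ->
  [/\ v = v *m proj10 J + v *m proj01 J, type10 J (v *m proj10 J) &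
      type01 J (v *m proj01 J)].
Proof.
move=> JJ.
have CJJ : cplx_mx J *m cplx_mx J = - 1%:M.
  by rewrite -cplx_mxM JJ /cplx_mx map_mxN map_mx1.
split.
- rewrite -mulmxDr /proj10 /proj01 -scalerDr addrACA addNr addr0 -mulr2n.
  by rewrite -scalerMnr scalerMnl half2 scale1r mulmx1.
- rewrite /type10 -mulmxA scalemxAr; congr (v *m _).
  rewrite /proj10 -scalemxAl scalerA [X in _ = X *: _]mulrC -scalerA; congr (_ *: _).
  rewrite mulmxBl mul1mx -scalemxAl CJJ scalerN opprK scalerBr scalerA mulii.
  by rewrite scaleN1r opprK addrC.
- rewrite /type01 -mulmxA scalemxAr; congr (v *m _).
  rewrite /proj01 -scalemxAl scalerA [X in _ = X *: _]mulrC -scalerA; congr (_ *: _).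
  rewrite mulmxDl mul1mx -scalemxAl CJJ scalerN scalerDr scalerA mulNr mulii opprK.
  by rewrite scale1r scaleNr addrC.
Qed.

Lemma mulmx1C_cast p q (A : 'M[C]_(p, q)) (B : 'M[C]_(q, p)) :
  p = q -> A *m B = 1%:M -> B *m A = 1%:M.
Proof. by move=> E; subst q; exact: mulmx1C. Qed.

(** The determinant of [J] has square [(-1) ^ n] and is real, which excludes
    odd [n]; hence [n./2] really is half of the dimension. *)
Lemma even_dim n (J : 'M[R]_n) : J *m J = - 1%:M -> n = (n./2 + n./2)%N.
Proof.
move=> JJ; suff no : odd n = false by rewrite addnn -[LHS]odd_double_half no.
apply/negbTE/negP => on.
have : \det J * \det J = -1.
  by rewrite -det_mulmx JJ -scaleN1r detZ det1 mulr1 -signr_odd on expr1.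
move=> H; have : 0 <= \det J * \det J by rewrite -expr2 sqr_ge0.
by rewrite H oppr_ge0 ler10.
Qed.

(** The value at a point of the canonical (1,0)-field built on a real vector;
    every (0,1)-vector is the conjugate of such a value, by [type01_hol_part]. *)
Definition hol_part d (J : 'M[R]_d) (u : 'rV[R]_d) : 'rV[C]_d :=
  cplx_mx u - 'i%C *: cplx_mx (u *m J).

Lemma hol_part_type10 d (J : 'M[R]_d) u : J *m J = - 1%:M ->
  type10 J (hol_part J u).
Proof.
move=> JJ; rewrite /type10 /hol_part mulmxBl -scalemxAl -!cplx_mxM -mulmxA JJ.
rewrite mulmxN mulmx1 scalerBr scalerA mulii scaleN1r opprK addrC.
by rewrite /cplx_mx map_mxN scalerN opprK.
Qed.

Lemma hol_part_neq0 d (J : 'M[R]_d) u : u != 0 -> hol_part J u != 0.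
Proof.
apply: contraNneq => /matrixP H; apply/eqP/rowP => a.
have := H 0 a; rewrite !mxE => /(congr1 (@complex.Re R)) /=.
by rewrite mul0r mulr0 subr0 subr0.
Qed.

(** Writing [z = p + i q], the equation [z J = - i z] says [p J = q], so that [z]
    is determined by its real part. *)
Lemma type01_hol_part d (J : 'M[R]_d) (z : 'rV[C]_d) : type01 J z ->
  z = conj_mx (hol_part J (re_mx z)).
Proof.
rewrite /type01 {1 2}(cplx_reim z) mulmxDl -scalemxAl -!cplx_mxM => H.
have E : - 'i%C *: (cplx_mx (re_mx z) + 'i%C *: cplx_mx (im_mx z)) =
    cplx_mx (im_mx z) + 'i%C *: cplx_mx (- re_mx z).
  rewrite scalerDr scalerA mulNr mulii opprK scale1r addrC; congr (_ + _).
  by rewrite /cplx_mx map_mxN scalerN scaleNr.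
have {H} := congr1 (@re_mx R 1 d) (etrans H E); rewrite !re_mx_reim => JE.
rewrite {1}(cplx_reim z) /hol_part conj_mxD conj_cplx_mx JE; congr (_ + _).
by rewrite -scaleNr conj_mxZ conj_Ni conj_cplx_mx.
Qed.

Lemma hol_part_blockl p q (A : 'M[R]_p) (B : 'M[R]_q) u :
  hol_part (block_mx A 0 0 B) (row_mx u 0) = row_mx (hol_part A u) 0.
Proof.
rewrite /hol_part mul_row_block !mul0mx !mulmx0 !addr0 /cplx_mx.
by rewrite !map_row_mx !map_mx0 scale_row_mx opp_row_mx add_row_mx scaler0 subr0.
Qed.

Lemma hol_part_blockr p q (A : 'M[R]_p) (B : 'M[R]_q) u :
  hol_part (block_mx A 0 0 B) (row_mx 0 u) = row_mx 0 (hol_part B u).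
Proof.
rewrite /hol_part mul_row_block !mul0mx !mulmx0 !add0r /cplx_mx.
by rewrite !map_row_mx !map_mx0 scale_row_mx opp_row_mx add_row_mx scaler0 subr0.
Qed.

Section Decomposition.
Variables (n : nat) (J : 'M[R]_n) (e th : 'I_(n./2) -> 'rV[C]_n).
Hypothesis JJ : J *m J = - 1%:M.
Hypothesis te : forall i, type10 J (e i).
Hypothesis the : forall i j, ev1 (th i) (e j) = (i == j)%:R.
Hypothesis thc : forall i j, ev1 (th i) (conj_mx (e j)) = 0.

(** The rows [e i] and their conjugates are dual to the [th i] and their
    conjugates, and there are [n] of them by [even_dim]: the two square matrices
    are inverse to each other on both sides. This expands [v] on the [e i] and
    their conjugates, and the conjugate part vanishes because it is both of type
    (1,0) and of type (0,1). *)
Lemma frame_decomp (v : 'rV[C]_n) : type10 J v ->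
  v = \sum_i ev1 (th i) v *: e i.
Proof.
move=> tv.
pose E : 'M[C]_(n./2, n) := \matrix_(i, a) e i 0 a.
pose Th : 'M[C]_(n./2, n) := \matrix_(i, a) th i 0 a.
have rowE i : row i E = e i by apply/rowP => a; rewrite !mxE.
have ETh (x : 'rV[C]_n) i : (x *m Th^T) 0 i = ev1 (th i) x.
  by rewrite ev1E mxE; apply: eq_bigr => a _; rewrite !mxE.
have E1 : E *m Th^T = 1%:M.
  apply/matrixP => i j; rewrite -[LHS]mul1r.
  have <- : (row i E *m Th^T) 0 j = (E *m Th^T) i j by rewrite -row_mul mxE.
  by rewrite ETh rowE the mul1r [RHS]mxE eq_sym.
have E0 : conj_mx E *m Th^T = 0.
  apply/matrixP => i j.
  have <- : (row i (conj_mx E) *m Th^T) 0 j = (conj_mx E *m Th^T) i j.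
    by rewrite -row_mul mxE.
  have -> : row i (conj_mx E) = conj_mx (e i).
    by rewrite -rowE; apply/rowP => a; rewrite !mxE.
  by rewrite ETh thc mxE.
have E1c : conj_mx E *m (conj_mx Th)^T = 1%:M.
  have -> : (conj_mx Th)^T = conj_mx (Th^T) by apply/matrixP => i j; rewrite !mxE.
  by rewrite -conj_mxM E1 /conj_mx map_mx1.
have E0c : E *m (conj_mx Th)^T = 0.
  have -> : (conj_mx Th)^T = conj_mx (Th^T) by apply/matrixP => i j; rewrite !mxE.
  by rewrite -[E]conj_mxK -conj_mxM E0 /conj_mx map_mx0.
have full : row_mx Th^T (conj_mx Th)^T *m col_mx E (conj_mx E) = 1%:M.
  apply: mulmx1C_cast; first by rewrite -(even_dim JJ).
  by rewrite mul_col_row E1 E0 E1c E0c -scalar_mx_block.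
have decE : v = v *m Th^T *m E + v *m (conj_mx Th)^T *m conj_mx E.
  by rewrite -!mulmxA -mulmxDr -mul_row_col full mulmx1.
have EJ : E *m cplx_mx J = 'i%C *: E.
  by apply/row_matrixP => i; rewrite row_mul rowE te linearZ /= rowE.
have EcJ : conj_mx E *m cplx_mx J = - 'i%C *: conj_mx E.
  by rewrite -(conj_cplx_mx J) -conj_mxM EJ conj_mxZ conj_i.
(* the conjugate component of [v] is of both types *)
have vE : v = v *m Th^T *m E.
  apply/eqP; rewrite -subr_eq0; apply/eqP; apply: (@type10_01_eq0 _ J).
    by rewrite /type10 mulmxBl tv -[_ *m _ *m E *m _]mulmxA EJ -scalemxAr scalerBr.
  rewrite {1}decE addrAC subrr add0r /type01.
  by rewrite -[_ *m _ *m conj_mx E *m _]mulmxA EcJ -scalemxAr.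
rewrite {1}vE mulmx_sum_row; apply: eq_bigr => i _.
by rewrite ETh rowE.
Qed.

Lemma coframe_type01 (v : 'rV[C]_n) i : type01 J v -> ev1 (th i) v = 0.
Proof.
move=> /type01_conj/frame_decomp H.
rewrite -[v]conj_mxK H conj_mx_sum /ev1 mulmx_suml summxE big1 // => j _.
by rewrite conj_mxZ -scalemxAl mxE -[X in _ * X]/(ev1 (th i) (conj_mx (e j))) thc mulr0.
Qed.

Lemma ev2_frame (om : 'M[C]_n) (v w : 'rV[C]_n) : type10 J v -> type10 J w ->
  ev2 om v (conj_mx w) =
  \sum_k \sum_l ev1 (th k) v * conjc (ev1 (th l) w) * ev2 om (e k) (conj_mx (e l)).
Proof.
move=> /frame_decomp Ev /frame_decomp Ew.
rewrite {1}Ev ev2_suml; apply: eq_bigr => k _.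
rewrite {1}Ew conj_mx_sum (eq_bigr (fun l => conjc (ev1 (th l) w) *: conj_mx (e l)));
  last by move=> l _; rewrite conj_mxZ.
by rewrite ev2_sumr mulr_sumr; apply: eq_bigr => l _; rewrite mulrA.
Qed.

Lemma metric_frame (g : 'M[R]_n) (v w : 'rV[C]_n) :
  (forall i j, metricC g (e i) (conj_mx (e j)) = (i == j)%:R) ->
  type10 J v -> type10 J w ->
  metricC g v (conj_mx w) = \sum_i ev1 (th i) v * conjc (ev1 (th i) w).
Proof.
move=> ge tv tw; rewrite /metricC ev2_frame //; apply: eq_bigr => k _.
rewrite (bigD1 k) //= -[ev2 _ _ _]/(metricC g _ _) ge eqxx mulr1 big1 ?addr0 // => l lk.
by rewrite -[ev2 _ _ _]/(metricC g _ _) ge eq_sym (negbTE lk) mulr0.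
Qed.

End Decomposition.

End FrameAlgebra.

(** * Smooth functions on open sets *)

Section LocalCalculus.
Context {R : realType} {V W : normedModType R}.
Implicit Types (U : set V) (f g : V -> W).

(** [g = f + (g - f)], and [g - f] vanishes near [x], hence is differentiable
    there with zero differential. *)
Lemma near_eq_differentiable f g x :
  (\near x, f x = g x) -> differentiable f x -> differentiable g x.
Proof.
move=> fg df.
have -> : g = f + (g - f) by rewrite addrC subrK.
apply: differentiableD => //.
have k0 : (g - f) x = 0.
  by rewrite /= !fctE (nbhs_singleton fg) subrr.
have H : (g - f) \o shift x = cst ((g - f) x) + (\0 : V -> W) +o_ 0 id.
  apply/eqaddoE; rewrite addr0 funeqE => h /=; rewrite k0 add0r.
  rewrite littleoE // => _/posnumP[e].
  have : \forall h \near (0 : V), f (h + x) = g (h + x).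
    have := fg; rewrite (near_shift 0 x) /=.
    by apply: filterS => z; rewrite /= subr0.
  apply: filterS => z E /=; rewrite !fctE E subrr normr0.
  by rewrite mulr_ge0.
apply/diff_locallyP.
have c0 : continuous (\0 : V -> W) by exact: cst_continuous.
rewrite (_ : 'd (g - f) x = \0 :> (V -> W)) //.
by apply/diff_unique.
Qed.

Lemma open_near U x : open U -> U x -> \forall y \near x, U y.
Proof. by move=> oU Ux; exact: open_nbhs_nbhs. Qed.

Lemma derive_eq_on U f g x v : open U -> (forall y, U y -> f y = g y) ->
  U x -> 'D_v f x = 'D_v g x.
Proof.
move=> oU fg Ux; apply: near_eq_derive.
by apply: filterS (open_near oU Ux) => y; exact: fg.
Qed.

Lemma Ck_on_ext k U f g : open U -> (forall x, U x -> f x = g x) ->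
  Ck_on k U f -> Ck_on k U g.
Proof.
elim: k f g => [|k IH] f g oU fg /=.
  move=> cf x Ux; suff : g y @[y --> x] --> g x by [].
  rewrite -fg //; apply: cvg_trans (cf x Ux); apply: near_eq_cvg.
  by apply: filterS (open_near oU Ux) => y /fg.
move=> [df Df]; split.
  move=> x Ux; apply: near_eq_differentiable (df x Ux).
  by apply: filterS (open_near oU Ux) => y; exact: fg.
move=> v; apply: IH (Df v) => // x Ux; exact: derive_eq_on fg Ux.
Qed.

Lemma smooth_on_ext U f g : open U -> (forall x, U x -> f x = g x) ->
  smooth_on U f -> smooth_on U g.
Proof. by move=> oU fg sf k; exact: Ck_on_ext fg (sf k). Qed.

Lemma smooth_on_sub U U' f : U' `<=` U -> smooth_on U f -> smooth_on U' f.
Proof.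
move=> UU sf k; have := sf k; elim: k f {sf} => [|k IH] f /=.
  by move=> cf x /UU; exact: cf.
by move=> [df Df]; split=> [x /UU|v]; [exact: df|exact: IH].
Qed.

Lemma smooth_on_differentiable U f x :
  smooth_on U f -> U x -> differentiable f x.
Proof. by move=> /(_ 1) [df _]; exact: df. Qed.

Lemma smooth_on_derive U f v : smooth_on U f -> smooth_on U ('D_v f).
Proof. by move=> sf k; have [_] := sf k.+1; apply. Qed.

Lemma Ck_onD k U f g : open U -> Ck_on k U f -> Ck_on k U g ->
  Ck_on k U (fun x => f x + g x).
Proof.
move=> oU; elim: k f g => [|k IH] f g /=.
  by move=> cf cg x Ux; apply: continuousD; [exact: cf|exact: cg].
move=> [df Df] [dg Dg]; split=> [x Ux|v].
  by apply: (@differentiableD _ _ _ f g); [exact: df|exact: dg].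
apply: (Ck_on_ext oU _ (IH _ _ (Df v) (Dg v))) => x Ux.
rewrite -deriveD //; apply: diff_derivable; [exact: df|exact: dg].
Qed.

Lemma Ck_on_cst k U (a : W) : Ck_on k U (fun=> a).
Proof.
elim: k a => [|k IH] a /=; first by move=> x _; exact: cst_continuous.
split=> [x _|v]; first exact: differentiable_cst.
rewrite (_ : 'D_v _ = fun=> 0) //; apply/funext => x; exact: derive_cst.
Qed.

Lemma smooth_on_cst U (a : W) : smooth_on U (fun=> a).
Proof. by move=> k; exact: Ck_on_cst. Qed.

Lemma smooth_onD U f g : open U -> smooth_on U f -> smooth_on U g ->
  smooth_on U (fun x => f x + g x).
Proof. by move=> oU sf sg k; exact: Ck_onD. Qed.

Lemma is_derive_line f (y v : V) (t : R) : differentiable f (t *: v + y) ->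
  is_derive t 1 (fun s : R => f (s *: v + y)) ('D_v f (t *: v + y)).
Proof.
move=> df.
have dl : is_diff t (fun s : R => s *: v + y) (fun s => s *: v).
  apply: is_diff_eq; rewrite addr0 //.
have dc : differentiable (fun s : R => f (s *: v + y)) t.
  exact: differentiable_comp.
apply: DeriveDef; first exact: diff_derivable.
rewrite deriveE // (@diff_comp _ _ _ _ (fun s : R => s *: v + y) f) //=.
by rewrite diff_val scale1r deriveE.
Qed.

End LocalCalculus.

Section Composition.
Context {R : realType} {V W Z : normedModType R}.

Lemma Ck_on_lin (L : {linear W -> Z}) k (U : set V) (f : V -> W) :
  continuous L -> open U -> Ck_on k U f -> Ck_on k U (L \o f).
Proof.
move=> cL oU; elim: k f => [|k IH] f /=.
  by move=> cf x Ux; apply: continuous_comp; [exact: cf|exact: cL].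
move=> [df Df]; split=> [x Ux|v].
  apply: differentiable_comp; [exact: df|exact: linear_differentiable].
apply: (Ck_on_ext oU _ (IH _ (Df v))) => x Ux /=.
have dL : differentiable (L \o f) x.
  by apply: differentiable_comp; [exact: df|exact: linear_differentiable].
rewrite (deriveE _ dL) (deriveE _ (df x Ux)).
rewrite (diff_comp (df x Ux) (linear_differentiable _ cL)) /=.
by rewrite diff_lin.
Qed.

Lemma smooth_on_lin (L : {linear W -> Z}) (U : set V) (f : V -> W) :
  continuous L -> open U -> smooth_on U f -> smooth_on U (fun x => L (f x)).
Proof. by move=> cL oU sf k; exact: Ck_on_lin. Qed.

Lemma Ck_on_comp_lin (L : {linear V -> W}) k (U : set W) (f : W -> Z) :
  continuous L -> open U -> Ck_on k U f -> Ck_on k (L @^-1` U) (f \o L).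
Proof.
move=> cL oU; have oLU : open (L @^-1` U) by exact: open_comp.
elim: k f => [|k IH] f /=.
  by move=> cf x Ux; apply: continuous_comp; [exact: cL|exact: cf].
move=> [df Df].
have dL x : differentiable L x by exact: linear_differentiable.
split=> [x Ux|v].
  by apply: differentiable_comp; [exact: dL|exact: df].
apply: (Ck_on_ext oLU _ (IH _ (Df (L v)))) => x Ux /=.
have dfL : differentiable (f \o L) x.
  by apply: differentiable_comp; [exact: dL|exact: df].
rewrite (deriveE _ dfL) (deriveE _ (df _ Ux)).
by rewrite (diff_comp (dL x) (df _ Ux)) /= diff_lin.
Qed.

Lemma smooth_on_comp_lin (L : {linear V -> W}) (U : set W) (f : W -> Z) :
  continuous L -> open U -> smooth_on U f ->
  smooth_on (L @^-1` U) (fun x => f (L x)).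
Proof. by move=> cL oU sf k; exact: Ck_on_comp_lin. Qed.

End Composition.

Section RealValued.
Context {R : realType} {V : normedModType R}.
Implicit Types (U : set V) (f g : V -> R).

Lemma Ck_onS k U f : Ck_on k.+1 U f -> Ck_on k U f.
Proof.
elim: k f => [|k IH] f [df Df].
  by move=> x Ux; apply: differentiable_continuous; exact: df.
by split=> // v; apply: IH; exact: Df.
Qed.

Lemma Ck_onM k U f g : open U -> Ck_on k U f -> Ck_on k U g ->
  Ck_on k U (fun x => f x * g x).
Proof.
move=> oU; elim: k f g => [|k IH] f g.
  by move=> /= cf cg x Ux; apply: continuousM; [exact: cf|exact: cg].
move=> Cf Cg; have [df Df] := Cf; have [dg Dg] := Cg; split=> [x Ux|v].
  by apply: (@differentiableM _ _ f g); [exact: df|exact: dg].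
have H := Ck_onD oU (IH _ _ (Ck_onS Cf) (Dg v)) (IH _ _ (Ck_onS Cg) (Df v)).
apply: (Ck_on_ext oU _ H) => x Ux.
rewrite [RHS](@deriveM _ _ f g) //; apply: diff_derivable; [exact: df|exact: dg].
Qed.

Lemma smooth_onM U f g : open U -> smooth_on U f -> smooth_on U g ->
  smooth_on U (fun x => f x * g x).
Proof. by move=> oU sf sg k; exact: Ck_onM. Qed.

Lemma smooth_onN U f : open U -> smooth_on U f -> smooth_on U (fun x => - f x).
Proof.
move=> oU sf; apply: (@smooth_on_ext _ _ _ U (fun x => -1 * f x)) => //.
  by move=> x _; rewrite mulN1r.
by apply: smooth_onM => //; exact: smooth_on_cst.
Qed.

Lemma smooth_on_sum U (I : Type) (r : seq I) (F : I -> V -> R) :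
  open U -> (forall i, smooth_on U (F i)) ->
  smooth_on U (fun x => \sum_(i <- r) F i x).
Proof.
move=> oO sF; elim: r => [|i r IH].
  by apply: smooth_on_ext (smooth_on_cst U 0) => // x _; rewrite big_nil.
by apply: smooth_on_ext (smooth_onD oO (sF i) IH) => // x _; rewrite big_cons.
Qed.

Lemma smooth_on_mx_entry (O : set V) p q (G : V -> 'M[R]_(p, q)) a b :
  open O -> smooth_on O G -> smooth_on O (fun x => G x a b).
Proof.
pose L := fun N : 'M[R]_(p, q) => N a b : R.
have linL : linear L by move=> k u v; rewrite /L !mxE.
pose Lm := GRing.isLinear.Build _ _ _ _ L linL.
pose LL : {linear _ -> _} := HB.pack L Lm.
move=> oO sG; apply: (@smooth_on_lin _ _ _ _ LL) => //.
exact: coord_continuous.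
Qed.

Lemma derive_invariant (f : V -> R) (x v : V) :
  (forall t : R, f (t *: v + x) = f x) -> 'D_v f x = 0.
Proof.
move=> H; rewrite /derive.
rewrite (_ : (fun h => _) = (fun=> 0)).
  by apply: cvg_lim => //; exact: cvg_cst.
by apply/funext => t /=; rewrite H subrr scaler0.
Qed.

(** The mean value theorem applied first in the direction [u], to the difference
    of [f] along two parallel segments, then in the direction [v]. *)
Lemma second_difference U f (x u v : V) (s : R) : 0 < s ->
  (forall y, U y -> differentiable f y) ->
  (forall y, U y -> differentiable ('D_u f) y) ->
  (forall a b, 0 <= a <= s -> 0 <= b <= s -> U (a *: u + (b *: v + x))) ->
  exists a b, [/\ 0 <= a <= s, 0 <= b <= s &
    f (s *: u + (s *: v + x)) - f (s *: u + x)
      - (f (s *: v + x) - f x) =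
    'D_v ('D_u f) (a *: u + (b *: v + x)) * s * s].
Proof.
move=> s0 df ddf HU.
have s1 : 0 <= s <= s by rewrite lexx ltW.
have s2 : 0 <= (0 : R) <= s by rewrite lexx ltW.
pose p (t : R) := f (t *: u + (s *: v + x)) - f (t *: u + (0 *: v + x)).
pose dp (t : R) := 'D_u f (t *: u + (s *: v + x)) - 'D_u f (t *: u + (0 *: v + x)).
have dpE t : 0 <= t <= s -> is_derive t 1 p (dp t).
  move=> ht; apply: is_deriveB; apply: is_derive_line; apply: df; exact: HU.
have [a|t|a asI Ha] := @MVT _ p dp 0 s s0.
- by rewrite in_itv /= => /andP[a0 as_]; apply: dpE; rewrite !ltW.
- apply: derivable_within_continuous => y.
  by rewrite in_itv /= => /dpE [].
have ha : 0 <= a <= s by move: asI; rewrite in_itv /= => /andP[a0 as_]; rewrite !ltW.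
pose q (t : R) := 'D_u f (t *: v + (a *: u + x)).
have dq t : 0 <= t <= s -> is_derive t 1 q ('D_v ('D_u f) (t *: v + (a *: u + x))).
  move=> ht; apply: is_derive_line; apply: ddf.
  by rewrite addrCA; exact: HU.
have [b|t|b bsI Hb] := @MVT _ q (fun t => 'D_v ('D_u f) (t *: v + (a *: u + x))) 0 s s0.
- by rewrite in_itv /= => /andP[a0 as_]; apply: dq; rewrite !ltW.
- apply: derivable_within_continuous => y.
  by rewrite in_itv /= => /dq [].
have hb : 0 <= b <= s by move: bsI; rewrite in_itv /= => /andP[a0 as_]; rewrite !ltW.
exists a, b; split => //.
move: Ha; rewrite /p !scale0r !add0r subr0 => ->.
rewrite /dp; congr (_ * s).
move: Hb; rewrite /q !scale0r !add0r subr0 => Hb.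
by rewrite [a *: u + (b *: v + x)]addrCA -Hb [a *: u + (s *: v + x)]addrCA.
Qed.

Lemma continuous_eq_at (F G : V -> R) (x : V) :
  {for x, continuous F} -> {for x, continuous G} ->
  (forall r : R, 0 < r -> exists y z, [/\ ball x r y, ball x r z & F y = G z]) ->
  F x = G x.
Proof.
move=> cF cG H; apply/eqP; rewrite -subr_eq0 -normr_le0.
apply/ler_addgt0Pl => /= e e0; rewrite addr0.
have e2 : 0 < e / 2 by rewrite divr_gt0.
have near_of (h : V -> R) : {for x, continuous h} ->
    \forall y \near x, `|h x - h y| < e / 2.
  by move=> /cvgrPdist_lt/(_ _ e2).
have /nbhs_ballP [r /= r0 Hr] :
    nbhs x [set y | `|F x - F y| < e / 2 /\ `|G x - G y| < e / 2].
  exact: filterI (near_of _ cF) (near_of _ cG).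
have [y [z [By Bz E]]] := H r r0.
have [H1 _] := Hr _ By; have [_ H2] := Hr _ Bz.
rewrite (splitr e) -(subrKA (F y)) (le_trans (ler_normD _ _)) // lerD //.
  exact: ltW.
by rewrite E distrC ltW.
Qed.

(** Symmetry of second derivatives: the second difference of [f] over a small
    parallelogram does not depend on the order of its two sides, and
    [second_difference] makes it a value of either mixed derivative near [x]. *)
Lemma schwarz U f (u v x : V) : open U -> smooth_on U f -> U x ->
  'D_u ('D_v f) x = 'D_v ('D_u f) x.
Proof.
move=> oU sf Ux.
have cts w z : {for x, continuous ('D_w ('D_z f))}.
  have := smooth_on_derive w (smooth_on_derive z sf).
  by move=> /(_ 0)/= /(_ x Ux).
apply: (@continuous_eq_at ('D_u ('D_v f)) ('D_v ('D_u f)) x (cts _ _) (cts _ _)).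
move=> r0 r0_gt0.
have /nbhs_ballP [r1 /= r1_gt0 Hr1] := open_near oU Ux.
pose r := Num.min r0 r1.
have r_gt0 : 0 < r by rewrite lt_min r0_gt0.
have Hr y : ball x r y -> U y.
  by move=> By; apply: Hr1; apply: le_ball By; rewrite ge_min lexx orbT.
(* small enough for the parallelogram of sides [s u], [s v] to stay in the ball *)
pose s := r / 2 / (`|u| + `|v| + 1).
have n0 : 0 < `|u| + `|v| + 1 by rewrite ltr_wpDl // addr_ge0.
have s0 : 0 < s by rewrite !divr_gt0.
have B a b : 0 <= a <= s -> 0 <= b <= s -> ball x r (a *: u + (b *: v + x)).
  move=> /andP[a0 as_] /andP[b0 bs].
  rewrite -ball_normE /= distrC addrA addrK.
  apply: (le_lt_trans (ler_normD _ _)); rewrite !normrZ !ger0_norm //.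
  apply: (@le_lt_trans _ _ (s * `|u| + s * `|v|)).
    by rewrite lerD // ler_wpM2r.
  rewrite -mulrDr; apply: (@le_lt_trans _ _ (s * (`|u| + `|v| + 1))).
    by rewrite ler_pM2l // lerDl.
  by rewrite /s divfK ?gt_eqF // ltr_pdivrMr // ltr_pMr // ltr1n.
have df y : U y -> differentiable f y by exact: smooth_on_differentiable.
have ddf w y : U y -> differentiable ('D_w f) y.
  by apply: smooth_on_differentiable; exact: smooth_on_derive.
have [a [b [ha hb E1]]] := second_difference s0 df (ddf u)
  (fun a b ha hb => Hr _ (B a b ha hb)).
have B' a' b' : 0 <= a' <= s -> 0 <= b' <= s -> ball x r (a' *: v + (b' *: u + x)).
  by move=> ha' hb'; rewrite addrCA; exact: B.
have [a' [b' [ha' hb' E2]]] := second_difference s0 df (ddf v)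
  (fun a b ha hb => Hr _ (B' a b ha hb)).
have le_r y : ball x r y -> ball x r0 y.
  by apply: le_ball; rewrite ge_min lexx.
exists (a' *: v + (b' *: u + x)), (a *: u + (b *: v + x)); split.
- exact/le_r/B'.
- exact/le_r/B.
have cancel_ss (p q : R) : p * s * s = q * s * s -> p = q.
  by move=> /(mulIf (lt0r_neq0 s0))/(mulIf (lt0r_neq0 s0)).
refine (cancel_ss _ _ (eq_trans (esym E2) (eq_trans _ E1))).
rewrite [s *: v + (s *: u + x)]addrCA.
move: (f _) (f _) (f _) (f _) => /= t1 t2 t3 t4; ring.
Qed.

(** Second derivative test along a line. If the second derivative at the maximum
    were positive, it would be positive on a small segment, and two applications
    of the mean value theorem, starting from the vanishing first derivative,
    would give a larger value of [f]. *)
Lemma local_max_line (U : set V) (f : V -> R) (x w : V) (d : R) :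
  open U -> smooth_on U f -> U x -> 0 < d ->
  (forall t : R, `|t| < d -> U (t *: w + x)) ->
  (forall t : R, `|t| < d -> f (t *: w + x) <= f x) ->
  'D_w f x = 0 /\ 'D_w ('D_w f) x <= 0.
Proof.
move=> oU sf Ux d0 HU Hmax.
pose F : V -> R := 'D_w f; pose G : V -> R := 'D_w ('D_w f).
have sF : smooth_on U F by exact: smooth_on_derive.
have dphi (t : R) : `|t| < d -> is_derive t 1 (fun s : R => f (s *: w + x)) (F (t *: w + x)).
  by move=> /HU Ut; apply: is_derive_line; apply: (smooth_on_differentiable sf Ut).
have dpsi (t : R) : `|t| < d -> is_derive t 1 (fun s : R => F (s *: w + x)) (G (t *: w + x)).
  by move=> /HU Ut; apply: is_derive_line; exact: smooth_on_differentiable sF Ut.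
have d00 : `|0 : R| < d by rewrite normr0.
have F0 : F x = 0.
  have H0 : is_derive (0 : R) 1 (fun s : R => f (s *: w + x)) 0.
    apply: (@derive1_at_max _ _ (- d) d).
    - by rewrite ltW // gtrN.
    - by move=> t; rewrite in_itv /= -ltr_norml => /dphi [].
    - by rewrite in_itv /= oppr_lt0 d0.
    - move=> t; rewrite in_itv /= -ltr_norml => /Hmax.
      by rewrite scale0r add0r.
  have [_ H1] := dphi 0 d00; have [_ H2] := H0.
  by move: H1; rewrite H2 scale0r add0r => <-.
split; first exact: F0.
have [//|G0] := lerP (G x) 0.
have cG : {for x, continuous G}.
  by have := smooth_on_derive w sF; move=> /(_ 0)/= /(_ x Ux).
have cline : {for (0 : R), continuous (fun t : R => G (t *: w + x))}.
  apply: differentiable_continuous; apply/derivable1_diffP.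
  have sG : smooth_on U G by exact: smooth_on_derive.
  have Dl : is_derive (0 : R) 1 (fun s : R => G (s *: w + x)) ('D_w G (0 *: w + x)).
    by apply: is_derive_line; apply: smooth_on_differentiable sG _; exact: HU.
  by case: Dl.
have /nbhs_ballP[r /= r0 Hr] : nbhs (0 : R) [set t : R | 0 < G (t *: w + x)].
  have := cline => /cvgr_gt; apply.
  by rewrite scale0r add0r.
pose s := Num.min d r / 2.
have m0 : 0 < Num.min d r by rewrite lt_min d0.
have s0 : 0 < s by rewrite divr_gt0.
have sm : s < Num.min d r by rewrite ltr_pdivrMr // ltr_pMr // ltr1n.
have [sd sr] : s < d /\ s < r by move: sm; rewrite lt_min => /andP.
have small (t : R) : 0 <= t <= s -> `|t| < d /\ 0 < G (t *: w + x).
  move=> /andP[t0 ts]; have nt : `|t| = t by exact: ger0_norm.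
  split; first by rewrite nt; exact: (le_lt_trans ts sd).
  by apply: Hr; rewrite /ball /= add0r normrN nt; exact: (le_lt_trans ts sr).
have [t|t|a aI Ha] := @MVT _ (fun s : R => f (s *: w + x)) (fun t => F (t *: w + x)) 0 s s0.
- by rewrite in_itv /= => /andP[t0 ts]; apply: dphi; apply: (small t _).1; rewrite !ltW.
- apply: derivable_within_continuous => y.
  by rewrite in_itv /= => /small[/dphi []].
have /andP[a0 as_] : 0 < a < s by move: aI; rewrite in_itv.
have [t|t|b bI Hb] := @MVT _ (fun s : R => F (s *: w + x)) (fun t => G (t *: w + x)) 0 a a0.
- rewrite in_itv /= => /andP[t0 ts]; apply: dpsi; apply: (small t _).1.
  by rewrite (ltW t0) ltW // (lt_trans ts).
- apply: derivable_within_continuous => y.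
  rewrite in_itv /= => /andP[y0 ya].
  have [] := small y; first by rewrite y0 (le_trans ya) // ltW.
  by move=> /dpsi[].
have /andP[b0 ba] : 0 < b < a by move: bI; rewrite in_itv.
have Gb : 0 < G (b *: w + x).
  by apply: (small b _).2; rewrite (ltW b0) ltW // (lt_trans ba).
have Fa : 0 < F (a *: w + x).
  move: Hb; rewrite scale0r add0r F0 !subr0 => ->.
  by rewrite mulr_gt0.
have : f (s *: w + x) <= f x.
  by apply: Hmax; apply: (small s _).1; rewrite lexx ltW.
move: Ha; rewrite scale0r add0r subr0 => Ha.
rewrite -subr_le0 Ha leNgt mulr_gt0 //.
Qed.

End RealValued.

(** * Differential calculus of complex functions and forms *)

Section ComplexCalculus.
Context {R : realType} {n : nat}.
Local Notation C := R[i].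
Local Notation T := 'rV[R]_n.
Implicit Types (O : set T) (h k : T -> C) (P Q : T -> 'rV[C]_n).

Definition smoothC O h : Prop :=
  smooth_on O (fun x => complex.Re (h x)) /\
  smooth_on O (fun x => complex.Im (h x)).

Definition pd (a : 'I_n) h (x : T) : C :=
  ('D_(basis_vec a) (fun y => complex.Re (h y)) x +i*
   'D_(basis_vec a) (fun y => complex.Im (h y)) x)%C.

(** The derivative along the complex tangent vector [v], complex linear in [v]. *)
Definition dir (v : 'rV[C]_n) h (x : T) : C := \sum_a v 0 a * pd a h x.

Lemma smoothC_ext O h k : open O -> (forall x, O x -> h x = k x) ->
  smoothC O h -> smoothC O k.
Proof.
move=> oO E [sr si]; split.
  by apply: smooth_on_ext sr => // x /E ->.
by apply: smooth_on_ext si => // x /E ->.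
Qed.

Lemma smoothC_cst O (c : C) : smoothC O (fun=> c).
Proof. by split; exact: smooth_on_cst. Qed.

Lemma smoothC_sub O O' h : O' `<=` O -> smoothC O h -> smoothC O' h.
Proof. by move=> OO [sr si]; split; exact: smooth_on_sub OO _. Qed.

Section OnOpenSet.
Variables (O : set T) (oO : open O).

Lemma smoothCD h k : smoothC O h -> smoothC O k ->
  smoothC O (fun x => h x + k x).
Proof.
move=> [hr hi] [kr ki]; split.
  by apply: smooth_on_ext (smooth_onD oO hr kr) => // x _; rewrite ReD.
by apply: smooth_on_ext (smooth_onD oO hi ki) => // x _; rewrite ImD.
Qed.

Lemma smoothCM h k : smoothC O h -> smoothC O k ->
  smoothC O (fun x => h x * k x).
Proof.
move=> [hr hi] [kr ki]; split.
  apply: smooth_on_ext (smooth_onD oO (smooth_onM oO hr kr)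
    (smooth_onN oO (smooth_onM oO hi ki))) => // x _; by rewrite ReM.
apply: smooth_on_ext (smooth_onD oO (smooth_onM oO hr ki)
  (smooth_onM oO hi kr)) => // x _; by rewrite ImM.
Qed.

Lemma smoothC_sum (I : Type) (r : seq I) (F : I -> T -> C) :
  (forall i, smoothC O (F i)) -> smoothC O (fun x => \sum_(i <- r) F i x).
Proof.
move=> sF; elim: r => [|i r IH].
  by apply: smoothC_ext (smoothC_cst O 0) => // x _; rewrite big_nil.
apply: smoothC_ext (smoothCD (sF i) IH) => // x _; by rewrite big_cons.
Qed.

Lemma smoothC_conj h : smoothC O h -> smoothC O (fun x => conjc (h x)).
Proof.
move=> [hr hi]; split.
  by apply: smooth_on_ext hr => // x _; case: (h x).
by apply: smooth_on_ext (smooth_onN oO hi) => // x _; case: (h x).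
Qed.

Lemma smoothC_pd a h : smoothC O h -> smoothC O (pd a h).
Proof. by move=> [hr hi]; split; exact: smooth_on_derive. Qed.

Lemma smoothC_dir P h : (forall a, smoothC O (fun x => P x 0 a)) ->
  smoothC O h -> smoothC O (fun x => dir (P x) h x).
Proof.
by move=> sP sh; apply: smoothC_sum => a; apply: smoothCM => //; exact: smoothC_pd.
Qed.

Lemma pd_eq_on a h k x : (forall y, O y -> h y = k y) -> O x ->
  pd a h x = pd a k x.
Proof.
move=> E Ox; congr (_ +i* _)%C; apply: (derive_eq_on _ oO _ Ox) => y /E ->;
  by [].
Qed.

Lemma dir_eq_on v h k x : (forall y, O y -> h y = k y) -> O x ->
  dir v h x = dir v k x.
Proof. by move=> E Ox; apply: eq_bigr => a _; rewrite (pd_eq_on a E Ox). Qed.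

Lemma pd_cst a (c : C) x : pd a (fun=> c) x = 0.
Proof. by rewrite /pd !derive_cst. Qed.

Let der (f : T -> R) x v : smooth_on O f -> O x -> derivable f x v.
Proof. by move=> sf Ox; apply: diff_derivable; exact: smooth_on_differentiable Ox. Qed.

Lemma pdD a h k x : smoothC O h -> smoothC O k -> O x ->
  pd a (fun y => h y + k y) x = pd a h x + pd a k x.
Proof.
move=> [hr hi] [kr ki] Ox; rewrite /pd.
rewrite (_ : (fun y => complex.Re (h y + k y)) =
  (fun y => complex.Re (h y)) + (fun y => complex.Re (k y))); last first.
  by apply/funext => y; rewrite fctE ReD.
rewrite (_ : (fun y => complex.Im (h y + k y)) =
  (fun y => complex.Im (h y)) + (fun y => complex.Im (k y))); last first.
  by apply/funext => y; rewrite fctE ImD.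
have [dhr dhi dkr dki] := And4 (@der _ x (basis_vec a) hr Ox) (@der _ x (basis_vec a) hi Ox)
   (@der _ x (basis_vec a) kr Ox) (@der _ x (basis_vec a) ki Ox).
by rewrite (deriveD dhr dkr) (deriveD dhi dki).
Qed.

Lemma pdM a h k x : smoothC O h -> smoothC O k -> O x ->
  pd a (fun y => h y * k y) x = pd a h x * k x + h x * pd a k x.
Proof.
move=> [hr hi] [kr ki] Ox; rewrite /pd.
have [dhr dhi dkr dki] := And4 (@der _ x (basis_vec a) hr Ox) (@der _ x (basis_vec a) hi Ox)
   (@der _ x (basis_vec a) kr Ox) (@der _ x (basis_vec a) ki Ox).
rewrite (_ : (fun y => complex.Re (h y * k y)) =
  (fun y => complex.Re (h y)) * (fun y => complex.Re (k y)) -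
  (fun y => complex.Im (h y)) * (fun y => complex.Im (k y))); last first.
  by apply/funext => y; rewrite !fctE ReM.
rewrite (_ : (fun y => complex.Im (h y * k y)) =
  (fun y => complex.Re (h y)) * (fun y => complex.Im (k y)) +
  (fun y => complex.Im (h y)) * (fun y => complex.Re (k y))); last first.
  by apply/funext => y; rewrite !fctE ImM.
rewrite (deriveB (derivableM dhr dkr) (derivableM dhi dki)).
rewrite (deriveD (derivableM dhr dki) (derivableM dhi dkr)).
rewrite (deriveM dhr dkr) (deriveM dhi dki) (deriveM dhr dki) (deriveM dhi dkr).
move: ('D_(_) _ x) ('D_(_) _ x) ('D_(_) _ x) ('D_(_) _ x) => /= A B D E.
by case: (h x) (k x) => [h1 h2] [k1 k2] /=; congr (_ +i* _)%C; rewrite /GRing.scale /=; ring.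
Qed.

Lemma pd_sum (I : Type) (r : seq I) (F : I -> T -> C) a x :
  (forall i, smoothC O (F i)) -> O x ->
  pd a (fun y => \sum_(i <- r) F i y) x = \sum_(i <- r) pd a (F i) x.
Proof.
move=> sF Ox; elim: r => [|i r IH].
  by rewrite big_nil -(@pd_eq_on a (fun=> 0)) ?pd_cst // => y _; rewrite big_nil.
rewrite big_cons -IH -pdD //; last exact: smoothC_sum.
by apply: pd_eq_on => // y _; rewrite big_cons.
Qed.

Lemma pd_conj a h x : smoothC O h -> O x ->
  pd a (fun y => conjc (h y)) x = conjc (pd a h x).
Proof.
move=> [hr hi] Ox; rewrite /pd /=; congr (_ +i* _)%C.
  by congr ('D_(_) _ x); apply/funext => y; case: (h y).
rewrite -(deriveN (@der _ x (basis_vec a) hi Ox)).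
by congr ('D_(_) _ x); apply/funext => y; rewrite fctE; case: (h y).
Qed.

Lemma pd_pdC a b h x : smoothC O h -> O x -> pd a (pd b h) x = pd b (pd a h) x.
Proof.
move=> [hr hi] Ox.
have Hr := schwarz (basis_vec a) (basis_vec b) oO hr Ox.
have Hi := schwarz (basis_vec a) (basis_vec b) oO hi Ox.
exact: (f_equal2 (@Complex R) Hr Hi).
Qed.

Lemma dirDl v w (h : T -> C) x : dir (v + w) h x = dir v h x + dir w h x.
Proof. by rewrite /dir -big_split; apply: eq_bigr => a _; rewrite !mxE mulrDl. Qed.

Lemma dirD v h k x : smoothC O h -> smoothC O k -> O x ->
  dir v (fun y => h y + k y) x = dir v h x + dir v k x.
Proof.
move=> sh sk Ox; rewrite /dir -big_split; apply: eq_bigr => a _ /=.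
by rewrite pdD // mulrDr.
Qed.

Lemma dirM v h k x : smoothC O h -> smoothC O k -> O x ->
  dir v (fun y => h y * k y) x = dir v h x * k x + h x * dir v k x.
Proof.
move=> sh sk Ox; rewrite /dir mulr_suml mulr_sumr -big_split.
by apply: eq_bigr => a _ /=; rewrite pdM //; ring.
Qed.

Lemma dir_cst v (c : C) x : dir v (fun=> c) x = 0.
Proof. by apply: big1 => a _; rewrite pd_cst mulr0. Qed.

Lemma dir_sum (I : Type) (r : seq I) (F : I -> T -> C) v x :
  (forall i, smoothC O (F i)) -> O x ->
  dir v (fun y => \sum_(i <- r) F i y) x = \sum_(i <- r) dir v (F i) x.
Proof.
move=> sF Ox; rewrite /dir exchange_big; apply: eq_bigr => a _ /=.
by rewrite pd_sum // mulr_sumr.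
Qed.

Lemma dir_conj v h x : smoothC O h -> O x ->
  dir (conj_mx v) (fun y => conjc (h y)) x = conjc (dir v h x).
Proof.
move=> sh Ox; rewrite /dir rmorph_sum; apply: eq_bigr => a _ /=.
by rewrite pd_conj // mxE rmorphM.
Qed.

Definition bracket P Q (x : T) : 'rV[C]_n :=
  \row_b (dir (P x) (fun y => Q y 0 b) x - dir (Q x) (fun y => P y 0 b) x).

(** The second order terms cancel by the symmetry of second derivatives. *)
Lemma dir_comm P Q h x : (forall a, smoothC O (fun x => P x 0 a)) ->
  (forall a, smoothC O (fun x => Q x 0 a)) -> smoothC O h -> O x ->
  dir (P x) (fun y => dir (Q y) h y) x - dir (Q x) (fun y => dir (P y) h y) x
  = dir (bracket P Q x) h x.
Proof.
move=> sP sQ sh Ox.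
have E P' Q' : (forall a, smoothC O (fun x => P' x 0 a)) ->
    (forall a, smoothC O (fun x => Q' x 0 a)) ->
    dir (P' x) (fun y => dir (Q' y) h y) x =
    \sum_b dir (P' x) (fun y => Q' y 0 b) x * pd b h x +
    \sum_b \sum_a P' x 0 a * Q' x 0 b * pd a (pd b h) x.
  move=> sP' sQ'.
  transitivity (dir (P' x) (fun y => \sum_b Q' y 0 b * pd b h y) x) => //.
  rewrite dir_sum //; last first.
    by move=> b; apply: smoothCM => //; exact: smoothC_pd.
  rewrite -big_split; apply: eq_bigr => b _ /=.
  rewrite dirM //; last exact: smoothC_pd.
  congr (_ + _); rewrite /dir mulr_sumr; apply: eq_bigr => a _.
  by rewrite mulrCA mulrA.
rewrite !E // {1}/dir.
rewrite [X in _ + X - _]exchange_big /= opprD addrACA.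
rewrite [X in _ + X](_ : _ = 0) ?addr0; last first.
  apply/eqP; rewrite subr_eq0; apply/eqP.
  apply: eq_bigr => b _; apply: eq_bigr => a _.
  by rewrite pd_pdC // [P x 0 b * _]mulrC.
rewrite -sumrB /dir; apply: eq_bigr => b _.
by rewrite !mxE mulrBl.
Qed.

Lemma smooth_cplx_comp (F : T -> 'rV[C]_n) b :
  smooth_cplx_on O F -> smoothC O (fun x => F x 0 b).
Proof.
move=> [sr si]; split.
  apply: smooth_on_ext (smooth_on_mx_entry 0 b oO sr) => // x _; by rewrite mxE.
apply: smooth_on_ext (smooth_on_mx_entry 0 b oO si) => // x _; by rewrite mxE.
Qed.

Lemma pderivE a (F : T -> 'rV[C]_n) x b : smooth_cplx_on O F -> O x ->
  pderiv a F x 0 b = pd a (fun y => F y 0 b) x.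
Proof.
move=> [sr si] Ox.
have D (G : T -> 'rV[R]_n) : smooth_on O G ->
    ('D_(basis_vec a) G x) 0 b = 'D_(basis_vec a) (fun y => G y 0 b) x.
  move=> sG; rewrite derive_mx ?mxE //.
  by apply: diff_derivable; exact: smooth_on_differentiable Ox.
rewrite /pderiv !mxE !D // /pd.
under eq_fun do rewrite mxE.
under [X in 'i%C * (real_complex R) ('D_(_) X x)]eq_fun do rewrite mxE.
by rewrite /real_complex_def; simpc.
Qed.

(** The invariant formula for the exterior derivative of a 1-form. It replaces
    the components of [ext_d] by derivatives along the fields at hand, whose
    brackets are known. *)
Lemma ext_dE (al : T -> 'rV[C]_n) P Q x : smooth_cplx_on O al ->
  (forall a, smoothC O (fun x => P x 0 a)) ->
  (forall a, smoothC O (fun x => Q x 0 a)) -> O x ->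
  ev2 (ext_d al x) (P x) (Q x) =
  dir (P x) (fun y => ev1 (al y) (Q y)) x - dir (Q x) (fun y => ev1 (al y) (P y)) x
  - ev1 (al x) (bracket P Q x).
Proof.
move=> sal sP sQ Ox.
have sa b := smooth_cplx_comp b sal.
have E P' Q' : (forall a, smoothC O (fun x => Q' x 0 a)) ->
    dir (P' x) (fun y => ev1 (al y) (Q' y)) x =
    \sum_b dir (P' x) (fun y => Q' y 0 b) x * al x 0 b +
    \sum_b \sum_a P' x 0 a * Q' x 0 b * pd a (fun y => al y 0 b) x.
  move=> sQ'.
  rewrite (@dir_eq_on _ _ (fun y => \sum_b Q' y 0 b * al y 0 b)) //; last first.
    by move=> y _; rewrite ev1E.
  rewrite dir_sum //; last by move=> b; exact: smoothCM.
  rewrite -big_split; apply: eq_bigr => b _ /=.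
  rewrite dirM //.
  congr (_ + _); rewrite /dir mulr_sumr; apply: eq_bigr => a _.
  by rewrite mulrCA mulrA.
rewrite !E // ev1E ev2E.
rewrite [X in _ + X - _ - _]exchange_big /=.
rewrite opprD addrACA [RHS]addrAC.
rewrite [X in X + _](_ : _ = 0) ?add0r; last first.
  apply/eqP; rewrite subr_eq0 -sumrB; apply/eqP; apply: eq_bigr => b _.
  by rewrite !mxE mulrBl.
rewrite -[RHS]sumrB; apply: eq_bigr => a _.
rewrite -[RHS]sumrB; apply: eq_bigr => b _.
have -> : ext_d al x a b =
    pd a (fun y => al y 0 b) x - pd b (fun y => al y 0 a) x.
  rewrite /ext_d mxE.
  exact: (f_equal2 (fun u v : C => u - v) (pderivE a b sal Ox) (pderivE b a sal Ox)).
by rewrite mulrBr [Q x 0 b * _]mulrC.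
Qed.

End OnOpenSet.

End ComplexCalculus.

(** * Covariant derivatives and the Bochner formula *)

Section Bochner.
Context {R : realType} {n N : nat}.
Local Notation C := R[i].
Local Notation T := 'rV[R]_n.
Variables (O : set T) (oO : open O).
Variable omega : 'I_N -> 'I_N -> T -> 'rV[C]_n.
Implicit Types (s t : 'I_N -> T -> C) (P Q : T -> 'rV[C]_n) (v w : 'rV[C]_n).

(** A section of [T'] is the family [s] of its components in a frame with
    connection forms [omega]; this is the [i]-th component of its covariant
    derivative along [v]. *)
Definition cov s v (i : 'I_N) (x : T) : C :=
  dir v (s i) x + \sum_j s j x * ev1 (omega j i x) v.

Definition herm s t (x : T) : C := \sum_i s i x * conjc (t i x).

Definition curv i j (x : T) : 'M[C]_n :=
  ext_d (omega i j) x + \sum_k wedge (omega k j x) (omega i k x).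

Hypothesis omega_smooth : forall i j, smooth_cplx_on O (omega i j).

Let smooth_field P := forall a, smoothC O (fun x => P x 0 a).

Lemma covD s v w i x : cov s (v + w) i x = cov s v i x + cov s w i x.
Proof.
rewrite /cov dirDl addrACA; congr (_ + _); rewrite -big_split.
by apply: eq_bigr => j _; rewrite ev1D mulrDr.
Qed.

Lemma smoothC_ev1 (al : T -> 'rV[C]_n) P : smooth_cplx_on O al ->
  smooth_field P -> smoothC O (fun x => ev1 (al x) (P x)).
Proof.
move=> sal sP.
apply: (@smoothC_ext _ _ _ (fun x => \sum_a P x 0 a * al x 0 a)) => //.
  by move=> x _; rewrite ev1E.
by apply: smoothC_sum => // a; apply: smoothCM => //; exact: smooth_cplx_comp.
Qed.

Lemma smoothC_cov s P i : (forall j, smoothC O (s j)) -> smooth_field P ->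
  smoothC O (fun x => cov s (P x) i x).
Proof.
move=> ss sP; apply: smoothCD => //; first exact: smoothC_dir.
apply: smoothC_sum => // j; apply: smoothCM => //.
exact: smoothC_ev1.
Qed.

Lemma smooth_conj P : smooth_field P -> smooth_field (fun x => conj_mx (P x)).
Proof.
move=> sP a; apply: (smoothC_ext oO _ (smoothC_conj oO (sP a))) => x _.
by rewrite mxE.
Qed.

(** Skew-Hermitian connection forms make the Hermitian product parallel. The
    conjugate of the derivative along [v] is the derivative of the conjugate along
    the conjugate of [v], hence the conjugate direction in the second term. *)
Lemma cov_herm s t v x : (forall i, smoothC O (s i)) ->
  (forall i, smoothC O (t i)) ->
  (forall i j, ev1 (omega i j x) v + conjc (ev1 (omega j i x) (conj_mx v)) = 0) ->
  O x ->
  dir v (herm s t) x =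
  \sum_i cov s v i x * conjc (t i x) +
  \sum_i s i x * conjc (cov t (conj_mx v) i x).
Proof.
move=> ss st skew Ox.
have sct i : smoothC O (fun x => conjc (t i x)) by exact: smoothC_conj.
rewrite /herm (dir_sum oO) //; last by move=> i; exact: smoothCM.
rewrite (eq_bigr (fun i => dir v (s i) x * conjc (t i x) +
    s i x * conjc (dir (conj_mx v) (t i) x))); last first.
  move=> i _; rewrite (dirM _ (O := O)) //; congr (_ + _ * _).
  by rewrite -(dir_conj (conj_mx v) (st i) Ox) conj_mxK.
rewrite big_split /=.
rewrite (eq_bigr (fun i => cov s v i x * conjc (t i x) -
    \sum_j s j x * ev1 (omega j i x) v * conjc (t i x))); last first.
  by move=> i _; rewrite /cov mulrDl mulr_suml addrK.
rewrite [X in _ + X](eq_bigr (fun i => s i x * conjc (cov t (conj_mx v) i x) +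
    \sum_j s i x * ev1 (omega i j x) v * conjc (t j x))); last first.
  move=> i _; rewrite /cov rmorphD mulrDr -addrA -[LHS]addr0; congr (_ + _).
  rewrite rmorph_sum mulr_sumr -big_split; apply/esym/big1 => j _ /=.
  rewrite rmorphM.
  have /eqP := skew i j; rewrite addr_eq0 => /eqP ->.
  by rewrite mulrN mulNr mulrA mulrAC addrN.
rewrite !big_split /= sumrN [X in _ - X]exchange_big /=.
rewrite [X in _ + X]addrC addrA; congr (_ + _).
by rewrite subrK.
Qed.

(** The commutator of covariant derivatives is the curvature: the terms with two
    derivatives of [s] give the bracket, the terms with one derivative of [s] are
    symmetric in [P] and [Q], and what is left is the exterior derivative of the
    connection forms plus their wedge products. *)
Lemma cov_commutator s P Q j x : (forall i, smoothC O (s i)) ->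
  smooth_field P -> smooth_field Q -> O x ->
  cov (fun i y => cov s (Q y) i y) (P x) j x -
  cov (fun i y => cov s (P y) i y) (Q x) j x - cov s (bracket P Q x) j x =
  \sum_i s i x * ev2 (curv i j x) (P x) (Q x).
Proof.
move=> ss sP sQ Ox.
have E P' Q' : smooth_field P' -> smooth_field Q' ->
    cov (fun i y => cov s (Q' y) i y) (P' x) j x =
    dir (P' x) (fun y => dir (Q' y) (s j) y) x +
    (\sum_i dir (P' x) (s i) x * ev1 (omega i j x) (Q' x) +
     \sum_i dir (Q' x) (s i) x * ev1 (omega i j x) (P' x)) +
    \sum_i s i x * (dir (P' x) (fun y => ev1 (omega i j y) (Q' y)) x +
      \sum_k ev1 (omega i k x) (Q' x) * ev1 (omega k j x) (P' x)).
  move=> sP' sQ'.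
  have so i := smoothC_ev1 (omega_smooth i j) sQ'.
  rewrite {1}/cov.
  transitivity (dir (P' x) (fun y => dir (Q' y) (s j) y +
      \sum_i s i y * ev1 (omega i j y) (Q' y)) x +
    \sum_k cov s (Q' x) k x * ev1 (omega k j x) (P' x)) => //.
  rewrite (dirD _ (O := O)) //; last 2 first.
  - exact: smoothC_dir.
  - by apply: smoothC_sum => // i; exact: (smoothCM oO (ss i) (so i)).
  rewrite (@dir_sum _ _ _ oO _ _ (fun i y => s i y * ev1 (omega i j y) (Q' y))) //;
    last by move=> i; exact: (smoothCM oO (ss i) (so i)).
  rewrite -!addrA; congr (_ + _).
  rewrite (eq_bigr (fun i => dir (P' x) (s i) x * ev1 (omega i j x) (Q' x) +
    s i x * dir (P' x) (fun y => ev1 (omega i j y) (Q' y)) x)); last first.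
    by move=> i _; rewrite (dirM _ (O := O)).
  rewrite big_split /= -addrA; congr (_ + _).
  rewrite [X in _ + X = _](eq_bigr (fun k => dir (Q' x) (s k) x * ev1 (omega k j x) (P' x) +
    \sum_i s i x * (ev1 (omega i k x) (Q' x) * ev1 (omega k j x) (P' x)))); last first.
    move=> k _; rewrite /cov mulrDl mulr_suml; congr (_ + _).
    by apply: eq_bigr => i _; rewrite mulrA.
  rewrite big_split /= addrCA; congr (_ + _).
  rewrite exchange_big -big_split; apply: eq_bigr => i _ /=.
  by rewrite mulrDr; congr (_ + _); rewrite mulr_sumr.
rewrite (E P Q) // (E Q P) //.
rewrite [X in _ - (_ + X + _) - _]addrC.
rewrite opprD addrACA [in X in X + _ - _]opprD.
rewrite [in X in X + _ - _]addrACA subrr addr0 (dir_comm oO) //.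
rewrite /cov opprD addrACA subrr add0r -!sumrB; apply: eq_bigr => i _.
rewrite -!mulrBr; congr (_ * _).
have curvE : ev2 (curv i j x) (P x) (Q x) =
    ev2 (ext_d (omega i j) x) (P x) (Q x) +
    \sum_k ev2 (wedge (omega k j x) (omega i k x)) (P x) (Q x).
  rewrite /curv /ev2 mulmxDr mulmxDl mxE; congr (_ + _).
  by rewrite mulmx_sumr mulmx_suml summxE.
rewrite curvE (ext_dE oO) //.
have -> : \sum_k ev2 (wedge (omega k j x) (omega i k x)) (P x) (Q x) =
    \sum_k ev1 (omega i k x) (Q x) * ev1 (omega k j x) (P x) -
    \sum_k ev1 (omega i k x) (P x) * ev1 (omega k j x) (Q x).
  rewrite -[RHS]sumrB; apply: eq_bigr => k _.
  by rewrite ev2_wedge [ev1 (omega k j x) (P x) * _]mulrC.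
move: (\sum_(k < N) _) (\sum_(k < N) _) (dir _ _ _) (dir _ _ _) (ev1 _ _).
by move=> S1 S2 a1 a2 b; ring.
Qed.

Variables (s : 'I_N -> T -> C) (Q : T -> 'rV[C]_n) (x : T).
Local Notation Qb := (fun y => conj_mx (Q y)).
Hypothesis ss : forall i, smoothC O (s i).
Hypothesis sQ : smooth_field Q.
Hypothesis Ox : O x.
Hypothesis skew : forall y i j v, O y ->
  ev1 (omega i j y) v + conjc (ev1 (omega j i y) (conj_mx v)) = 0.
Hypothesis hol : forall y i, O y -> cov s (Qb y) i y = 0.

(** Bochner formula for a section [s] that is holomorphic along [Q], in the sense
    that its covariant derivative along the conjugate of [Q] vanishes. The first
    derivative of [|s|^2] along [Qb] is the product of [s] with its covariant
    derivative along [Q]. Differentiating along [Q] gives the square norm of that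
    covariant derivative and the product of [s] with its second covariant
    derivative along [Qb] after [Q]; commuting the two turns the latter into
    curvature and a derivative along the bracket [Z1 + Z2]. The hypotheses on
    [Z1] and [Z2] hold for the parts of type (1,0) and (0,1) of the bracket when
    [x] is a critical point of [|s|^2], and make the bracket term vanish. *)
Lemma bochner (Z1 Z2 : 'rV[C]_n) :
  bracket Q Qb x = Z1 + Z2 ->
  (forall i, cov s Z2 i x = 0) -> (forall i, cov s (conj_mx Z1) i x = 0) ->
  dir (conj_mx Z1) (herm s s) x = 0 ->
  dir (Q x) (fun y => dir (Qb y) (herm s s) y) x =
  \sum_i cov s (Q x) i x * conjc (cov s (Q x) i x) -
  conjc (\sum_i \sum_j ev2 (curv i j x) (Q x) (Qb x) * s i x * conjc (s j x)).
Proof.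
move=> BE H2 H1 crit.
have sQb : smooth_field Qb by exact: smooth_conj.
pose t i y := cov s (Q y) i y.
have st i : smoothC O (t i) by exact: smoothC_cov.
have skewx i j v : ev1 (omega i j x) v + conjc (ev1 (omega j i x) (conj_mx v)) = 0.
  exact: skew.
rewrite (@dir_eq_on _ _ O oO _ _ (herm s t)) //; last first.
  move=> y Oy; rewrite (cov_herm ss ss) //; last by move=> i j; exact: skew.
  rewrite big1 ?add0r; last by move=> i _; rewrite hol // mul0r.
  by rewrite conj_mxK.
rewrite (cov_herm ss st) //; congr (_ + _).
rewrite raddf_sum -sumrN.
have commE i : cov t (Qb x) i x =
    - cov s Z1 i x - \sum_k s k x * ev2 (curv k i x) (Q x) (Qb x).
  have A0 : cov (fun i y => cov s (Qb y) i y) (Q x) i x = 0.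
    rewrite /cov (@dir_eq_on _ _ O oO _ _ (fun=> 0)) //; last by move=> y Oy; exact: hol.
    rewrite dir_cst big1 ?addr0 // => k _.
    by have := hol k Ox; rewrite /cov => ->; rewrite mul0r.
  have := cov_commutator i ss sQ sQb Ox.
  rewrite A0 BE covD H2 addr0 sub0r => <-.
  move: (cov _ _ _ _) (cov _ _ _ _) => B D; ring.
(* by [H1], the derivative of [|s|^2] along [conj_mx Z1] reduces to this sum *)
have crit' : \sum_i s i x * conjc (cov s Z1 i x) = 0.
  move: crit; rewrite (cov_herm ss ss) //.
  rewrite big1 ?add0r ?conj_mxK // => i _; by rewrite H1 mul0r.
rewrite (eq_bigr (fun i => - (s i x * conjc (cov s Z1 i x)) -
  \sum_k conjc (ev2 (curv k i x) (Q x) (Qb x) * s k x * conjc (s i x)))); last first.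
  move=> i _; rewrite commE rmorphD !rmorphN mulrDr mulrN; congr (_ + _).
  rewrite mulrN rmorph_sum mulr_sumr; congr (- _); apply: eq_bigr => k _.
  rewrite !rmorphM /= conjcK.
  by rewrite mulrC [X in X * s i x]mulrC.
rewrite big_split /= sumrN crit' oppr0 add0r sumrN exchange_big /= -sumrN.
by apply: eq_bigr => i _; rewrite rmorph_sum.
Qed.

End Bochner.

(** * The canonical connection in a unitary frame *)

Section FrameGeometry.
Context {R : realType} {n : nat} {M : @charted_space R n}.
Local Notation C := R[i].
Local Notation T := 'rV[R]_n.
Variables (J g : mx_field M) (D : christoffel M) (c : chart_index M).
Variables (O : set T) (F : frame_data (R := R) (n := n)).
Hypothesis uF : unitary_frame_on J g D c O F.

Let oO : open O. Proof. by case: uF => -[]. Qed.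

Let subO y : O y -> cimg c y. Proof. by case: uF => -[_ H] *; exact: H. Qed.

Let s_fr i : smooth_cplx_on O (frame F i). Proof. by case: uF => _ [H _]. Qed.

Let s_cof i : smooth_cplx_on O (coframe F i). Proof. by case: uF => _ [_ [H _]]. Qed.

Let frame_type y i : O y -> type10 (J c y) (frame F i y).
Proof. by move=> Oy; case: uF => _ _ /(_ y Oy)[]. Qed.

Let frame_metric y i j : O y ->
  metricC (g c y) (frame F i y) (conj_mx (frame F j y)) = (i == j)%:R.
Proof. by move=> Oy; case: uF => _ _ /(_ y Oy)[]. Qed.

Let dual y i j : O y -> ev1 (coframe F i y) (frame F j y) = (i == j)%:R.
Proof. by move=> Oy; case: uF => _ _ _ /(_ y i j Oy)[]. Qed.

Let dualc y i j : O y -> ev1 (coframe F i y) (conj_mx (frame F j y)) = 0.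
Proof. by move=> Oy; case: uF => _ _ _ /(_ y i j Oy)[]. Qed.

Section Skew.
Hypothesis sg : smooth_on (cimg c) (g c).
Hypothesis pg : parallel_metric D g.

Lemma frame_nabla y i a : O y ->
  pderiv a (frame F i) y + frame F i y *m cplx_mx (D c a y) =
  \sum_j conn_form F i j y 0 a *: frame F j y.
Proof.
move=> Oy; case: uF => _ _ _ _ /(_ y i (delta_mx 0 a) Oy).
rewrite /nablaC (bigD1 a) //= mxE !eqxx scale1r big1 ?addr0; last first.
  by move=> b ba; rewrite mxE (negbTE ba) andbF scale0r.
move=> ->; apply: eq_bigr => j _; congr (_ *: _).
rewrite ev1E (bigD1 a) //= mxE !eqxx mul1r big1 ?addr0 // => b ba.
by rewrite mxE (negbTE ba) andbF mul0r.
Qed.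

Lemma smoothC_g a b : smoothC O (fun y => (((g c y) a b)%:C)%C).
Proof.
split; last exact: smooth_on_cst.
apply: smooth_on_mx_entry => //; apply: smooth_on_sub sg; exact: subO.
Qed.

Lemma pd_g a y : O y ->
  \matrix_(b, d) pd a (fun z => (((g c z) b d)%:C)%C) y =
  cplx_mx (D c a y) *m cplx_mx (g c y) + cplx_mx (g c y) *m (cplx_mx (D c a y))^T.
Proof.
move=> Oy.
have H := pg a (subO Oy).
have -> : (cplx_mx (D c a y))^T = cplx_mx (D c a y)^T by apply/matrixP => i j; rewrite !mxE.
rewrite -!cplx_mxM.
have -> : cplx_mx (D c a y *m g c y) + cplx_mx (g c y *m (D c a y)^T) =
    cplx_mx ('D_(basis_vec a) (g c) y).
  rewrite -[LHS]map_mxD; congr (cplx_mx _); apply/eqP.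
  by rewrite -subr_eq0 -oppr_eq0 opprB opprD addrA H.
apply/matrixP => b d; rewrite [RHS]mxE mxE derive_mx; last first.
  apply: diff_derivable; apply: (smooth_on_differentiable sg); exact: subO.
rewrite mxE /pd /= (_ : 'D__ (fun=> 0) _ = 0) //.
exact: derive_cst.
Qed.

(** The derivative of the constant products of the frame vectors, in which the
    parallelism of the metric replaces the derivative of [g] by Christoffel
    symbols; together with the derivatives of the frame these form the covariant
    derivatives of [frame_nabla]. *)
Lemma conn_skew_comp y i j a : O y ->
  conn_form F i j y 0 a + conjc (conn_form F j i y 0 a) = 0.
Proof.
move=> Oy.
have sfr i' b := smooth_cplx_comp oO b (s_fr i').
have sfc i' b := smoothC_conj oO (sfr i' b).
pose h z := \sum_b \sum_d frame F i z 0 b * conjc (frame F j z 0 d) *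
   (((g c z) b d)%:C)%C.
have hE z : O z -> h z = (i == j)%:R.
  move=> Oz; rewrite -(frame_metric i j Oz) /metricC ev2E.
  by apply: eq_bigr => b _; apply: eq_bigr => d _; rewrite !mxE.
have : pd a h y = 0.
  by rewrite (@pd_eq_on _ _ O oO a h (fun=> (i == j)%:R)) // pd_cst.
have sh b d : smoothC O (fun z => frame F i z 0 b * conjc (frame F j z 0 d) *
   (((g c z) b d)%:C)%C).
  by apply: smoothCM => //; [apply: smoothCM|exact: smoothC_g].
rewrite /h (pd_sum oO) //; last by move=> b; exact: smoothC_sum.
under eq_bigr => b _.
  rewrite (pd_sum oO) //.
  under eq_bigr => d _.
    rewrite (pdM a (smoothCM oO (sfr i b) (sfc j d)) (smoothC_g b d) Oy).
    rewrite (pdM a (sfr i b) (sfc j d) Oy) (pd_conj a (sfr j d) Oy).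
    rewrite -(pderivE a b (s_fr i) Oy) -(pderivE a d (s_fr j) Oy).
    over.
  over.
pose G := cplx_mx (g c y).
pose p := pderiv a (frame F i) y; pose q := pderiv a (frame F j) y.
pose e := frame F i y; pose f := frame F j y; pose K := cplx_mx (D c a y).
move=> H.
have {}H : ev2 G p (conj_mx f) + ev2 G e (conj_mx q) +
    ev2 (K *m G + G *m K^T) e (conj_mx f) = 0.
  rewrite -[RHS]H -(pd_g a Oy) !ev2E -!big_split; apply: eq_bigr => b _ /=.
  rewrite -!big_split; apply: eq_bigr => d _ /=.
  by rewrite [(\matrix_(_, _) _) b d]mxE [G b d]mxE [conj_mx f 0 d]mxE
    [conj_mx q 0 d]mxE; rewrite /p /q /e /f; ring.
(* collect the derivatives of the frame with the Christoffel symbols *)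
have cK : conj_mx K = K by exact: conj_cplx_mx.
have {}H p' q' : p + e *m K = p' -> q + f *m K = q' ->
    ev2 G p' (conj_mx f) + ev2 G e (conj_mx q') = 0.
  move=> <- <-.
  have EKl : ev2 G (e *m K) (conj_mx f) = ev2 (K *m G) e (conj_mx f).
    by rewrite /ev2 !mulmxA.
  have EKr : ev2 G e (conj_mx f *m K) = ev2 (G *m K^T) e (conj_mx f).
    by rewrite /ev2 trmx_mul !mulmxA.
  rewrite -[RHS]H conj_mxD conj_mxM cK ev2Dl ev2Dr ev2Dm EKl EKr.
  exact: addrACA.
have Ep : p + e *m K = \sum_k conn_form F i k y 0 a *: frame F k y by exact: frame_nabla.
have Eq : q + f *m K = \sum_k conn_form F j k y 0 a *: frame F k y by exact: frame_nabla.
have := H _ _ Ep Eq; rewrite conj_mx_sum ev2_suml.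
rewrite [X in ev2 G e X](eq_bigr (fun k => conjc (conn_form F j k y 0 a) *:
  conj_mx (frame F k y))); last by move=> k _; rewrite conj_mxZ.
rewrite ev2_sumr.
have Gm k l : ev2 G (frame F k y) (conj_mx (frame F l y)) = (k == l)%:R.
  exact: frame_metric.
rewrite (bigD1 j) //= Gm eqxx mulr1 big1 ?addr0; last first.
  by move=> k kj; rewrite Gm (negbTE kj) mulr0.
rewrite (bigD1 i) //= Gm eqxx mulr1 big1 ?addr0 // => k ki.
by rewrite Gm eq_sym (negbTE ki) mulr0.
Qed.

Lemma conn_skew y i j v : O y ->
  ev1 (conn_form F i j y) v + conjc (ev1 (conn_form F j i y) (conj_mx v)) = 0.
Proof.
move=> Oy; rewrite !ev1E rmorph_sum -big_split big1 //= => a _.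
rewrite rmorphM mxE /= conjcK -mulrDr.
by rewrite (conn_skew_comp i j a Oy) mulr0.
Qed.

End Skew.

(** The torsion of the commuting fields [P] and [conj Q] is the covariant
    derivative of [conj Q] along [P] minus that of [P] along [conj Q]. The
    connection preserves types, so the first is of type (0,1) and the components of
    [torsion_form] see only the second, which vanishes with the (1,1) part of the
    torsion. *)
Lemma torsion_hol (P Q : T -> 'rV[C]_n) :
  (forall x, cimg c x -> J c x *m J c x = - 1%:M) ->
  (forall x i, O x -> part11 (J c x) (torsion_form F i x) = 0) ->
  (forall a, smoothC O (fun x => P x 0 a)) ->
  (forall a, smoothC O (fun x => Q x 0 a)) ->
  (forall x, O x -> type10 (J c x) (P x)) ->
  (forall x, O x -> type10 (J c x) (Q x)) ->
  (forall x, O x -> bracket P (fun y => conj_mx (Q y)) x = 0) ->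
  forall x i, O x ->
  cov (conn_form F) (fun i y => ev1 (coframe F i y) (P y)) (conj_mx (Q x)) i x = 0.
Proof.
move=> JJ tors sP sQ tP tQ PQ x i Ox.
have sQb := smooth_conj oO sQ.
have H : ev2 (torsion_form F i x) (P x) (conj_mx (Q x)) = 0.
  rewrite -(@ev2_part11 _ _ (J c x)) ?tors //; [|exact: tP|exact/type10_conj/tQ].
  by rewrite /ev2 mulmx0 mul0mx mxE.
have th0 y j : O y -> ev1 (coframe F j y) (conj_mx (Q y)) = 0.
  move=> Oy; apply: (@coframe_type01 _ _ (J c y) (fun i => frame F i y)
    (fun i => coframe F i y)).
  - exact/JJ/subO.
  - by move=> k; exact: frame_type.
  - by move=> k l; exact: dual.
  - by move=> k l; exact: dualc.
  - exact/type10_conj/tQ.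
have E : ev2 (torsion_form F i x) (P x) (conj_mx (Q x)) =
    ev2 (ext_d (coframe F i) x) (P x) (conj_mx (Q x)) +
    \sum_j ev2 (wedge (conn_form F j i x) (coframe F j x)) (P x) (conj_mx (Q x)).
  rewrite /torsion_form /ev2 mulmxDr mulmxDl mxE; congr (_ + _).
  by rewrite mulmx_sumr mulmx_suml summxE.
move: H; rewrite E.
have -> := ext_dE oO (s_cof i) sP sQb Ox.
have e0 : ev1 (coframe F i x) 0 = 0 by rewrite /ev1 mul0mx mxE.
rewrite PQ // e0 subr0.
rewrite (@dir_eq_on _ _ O oO _ _ (fun=> 0)) //; last by move=> y Oy; exact: th0.
rewrite dir_cst sub0r.
rewrite (eq_bigr (fun j => - (ev1 (coframe F j x) (P x) *
    ev1 (conn_form F j i x) (conj_mx (Q x))))); last first.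
  by move=> j _; rewrite ev2_wedge th0 // mulr0 sub0r.
rewrite sumrN -opprD => /eqP; rewrite oppr_eq0 => /eqP.
by [].
Qed.

Lemma bisectional_numerator x (V W : 'rV[C]_n) : O x ->
  J c x *m J c x = - 1%:M -> type10 (J c x) V -> type10 (J c x) W ->
  bisectional J g c F x V W =
  (\sum_i \sum_j ev2 (curv (conn_form F) i j x) W (conj_mx W) *
     ev1 (coframe F i x) V * conjc (ev1 (coframe F j x) V)) /
  (normsq (g c x) V * normsq (g c x) W).
Proof.
move=> Ox JJ tV tW; rewrite /bisectional /=; congr (_ / _).
apply: eq_bigr => i _; apply: eq_bigr => j _.
rewrite (@ev2_frame _ _ (J c x) (fun i => frame F i x) (fun i => coframe F i x)) //;
  [|by move=> k; exact: frame_type|by move=> k l; exact: dual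
   |by move=> k l; exact: dualc].
rewrite -mulrA mulr_suml; apply: eq_bigr => k _.
rewrite mulr_suml; apply: eq_bigr => l _.
rewrite /curv_coef ev2_part11; [|exact: frame_type|exact/type10_conj/frame_type].
rewrite -[curvature_form F i j x]/(curv (conn_form F) i j x).
by ring.
Qed.

Lemma normsq_frame x (V : 'rV[C]_n) : O x -> J c x *m J c x = - 1%:M ->
  type10 (J c x) V ->
  normsq (g c x) V = \sum_i ev1 (coframe F i x) V * conjc (ev1 (coframe F i x) V).
Proof.
move=> Ox JJ tV.
apply: (@metric_frame _ _ (J c x) (fun i => frame F i x)
  (fun i => coframe F i x)) => //.
- by move=> k; exact: frame_type.
- by move=> k l; exact: dual.
- by move=> k l; exact: dualc.
- by move=> k l; exact: frame_metric.
Qed.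

End FrameGeometry.

(** * The Levi form at a maximum *)

Section SecondOrder.
Context {R : realType} {d : nat}.
Local Notation C := R[i].
Local Notation T := 'rV[R]_d.
Variables (O : set T) (oO : open O).

Lemma derive_basis (f : T -> R) (w x : T) : differentiable f x ->
  'D_w f x = \sum_a w 0 a * 'D_(basis_vec a) f x.
Proof.
move=> df; rewrite deriveE // {1}(row_sum_delta w) linear_sum.
by apply: eq_bigr => a _; rewrite linearZ deriveE.
Qed.

Lemma dir_cplx (w : T) (h : T -> C) x : smoothC O h -> O x ->
  dir (cplx_mx w) h x =
  ('D_w (fun y => complex.Re (h y)) x +i* 'D_w (fun y => complex.Im (h y)) x)%C.
Proof.
move=> [hr hi] Ox.
have dr := smooth_on_differentiable hr Ox; have di := smooth_on_differentiable hi Ox.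
rewrite (derive_basis _ dr) (derive_basis _ di) /dir.
apply/eqP; rewrite eq_complex /=; apply/andP; split; apply/eqP.
  elim/big_rec2: _ => // a p q _ <-; rewrite ReD; congr (_ + _).
  by rewrite mxE /pd /= mul0r subr0.
elim/big_rec2: _ => // a p q _ <-; rewrite ImD; congr (_ + _).
by rewrite mxE /pd /= mul0r addr0.
Qed.

Lemma Re_dir_dir_cplx (w : T) (h : T -> C) x : smoothC O h -> O x ->
  complex.Re (\sum_a \sum_b ((w 0 b * w 0 a)%:C)%C * pd b (pd a h) x) =
  'D_w ('D_w (fun y => complex.Re (h y))) x.
Proof.
move=> sh Ox.
have -> : \sum_a \sum_b ((w 0 b * w 0 a)%:C)%C * pd b (pd a h) x =
    dir (cplx_mx w) (fun y => dir (cplx_mx w) h y) x.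
  transitivity (dir (cplx_mx w) (fun y => \sum_a cplx_mx w 0 a * pd a h y) x) => //.
  rewrite (@dir_sum _ _ O oO _ _ (fun a y => cplx_mx w 0 a * pd a h y)) //; last first.
    move=> a; apply: (smoothCM oO); [exact: smoothC_cst|exact: smoothC_pd].
  apply: eq_bigr => a _.
  rewrite (dirM _ (smoothC_cst O _) (smoothC_pd a sh) Ox) dir_cst mul0r add0r.
  rewrite /dir mulr_sumr; apply: eq_bigr => b _.
  by rewrite !mxE mulrA -rmorphM [w 0 a * _]mulrC.
rewrite (@dir_eq_on _ _ O oO _ _ (fun y => ('D_w (fun y => complex.Re (h y)) y +i*
  'D_w (fun y => complex.Im (h y)) y)%C)) //; last by move=> y Oy; exact: dir_cplx.
by rewrite dir_cplx //; case: sh => hr hi; split; exact: smooth_on_derive.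
Qed.

(** With [Q = w - i w'], the second order part of the derivative of [h] along [Q]
    and [conj Q] has real part [Hess (w, w) + Hess (w', w')]. The last hypothesis
    kills the first order part: it holds at a critical point for the directions in
    which [Q] varies. *)
Lemma levi_nonpos (h : T -> C) (Q : T -> 'rV[C]_d) (x w w' : T) :
  smoothC O h -> (forall y, O y -> complex.Im (h y) = 0) -> O x ->
  (forall a, smoothC O (fun y => Q y 0 a)) ->
  Q x = cplx_mx w - 'i%C *: cplx_mx w' ->
  ('D_w ('D_w (fun y => complex.Re (h y))) x : R) <= 0 ->
  ('D_w' ('D_w' (fun y => complex.Re (h y))) x : R) <= 0 ->
  (forall a, dir (Q x) (fun y => conj_mx (Q y) 0 a) x * pd a h x = 0) ->
  complex.Re (dir (Q x) (fun y => dir (conj_mx (Q y)) h y) x) <= 0.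
Proof.
move=> sh h0 Ox sQ QE Hw Hw' crit.
have sQb := smooth_conj oO sQ.
have -> : dir (Q x) (fun y => dir (conj_mx (Q y)) h y) x =
    \sum_a \sum_b Q x 0 b * conjc (Q x 0 a) * pd b (pd a h) x.
  transitivity (dir (Q x) (fun y => \sum_a conj_mx (Q y) 0 a * pd a h y) x) => //.
  rewrite (@dir_sum _ _ O oO _ _ (fun a y => conj_mx (Q y) 0 a * pd a h y)) //; last first.
    by move=> a; apply: (smoothCM oO); [exact: sQb|exact: smoothC_pd].
  apply: eq_bigr => a _.
  rewrite (dirM _ (sQb a) (smoothC_pd a sh) Ox) crit add0r.
  rewrite /dir mulr_sumr; apply: eq_bigr => b _.
  by rewrite mxE mulrA [conjc _ * _]mulrC.
have real_hess a b : complex.Im (pd b (pd a h) x) = 0.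
  rewrite /pd /=.
  rewrite (derive_eq_on _ oO (g := fun=> 0)) ?derive_cst // => y Oy.
  by rewrite (derive_eq_on _ oO (g := fun=> 0)) ?derive_cst.
have E a b : complex.Re (Q x 0 b * conjc (Q x 0 a) * pd b (pd a h) x) =
    complex.Re (((w 0 b * w 0 a)%:C)%C * pd b (pd a h) x) +
    complex.Re (((w' 0 b * w' 0 a)%:C)%C * pd b (pd a h) x).
  rewrite QE !mxE; case: (pd b _ x) (real_hess a b) => h1 h2 /= ->.
  by ring.
have Re_sum (I : finType) (G : I -> C) :
    complex.Re (\sum_i G i) = \sum_i complex.Re (G i).
  by elim/big_rec2: _ => // i p q _ <-; rewrite ReD.
rewrite Re_sum.
have -> : \sum_a complex.Re (\sum_b Q x 0 b * conjc (Q x 0 a) * pd b (pd a h) x) =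
  complex.Re (\sum_a \sum_b ((w 0 b * w 0 a)%:C)%C * pd b (pd a h) x) +
  complex.Re (\sum_a \sum_b ((w' 0 b * w' 0 a)%:C)%C * pd b (pd a h) x).
  rewrite !Re_sum -big_split; apply: eq_bigr => a _ /=.
  by rewrite !Re_sum -big_split; apply: eq_bigr => b _.
have nonpos (r1 r2 : R) : r1 <= 0 -> r2 <= 0 -> r1 + r2 <= 0.
  by move=> r10 r20; rewrite -[leRHS]addr0 lerD.
apply: nonpos.
  by rewrite (Re_dir_dir_cplx w sh Ox).
by rewrite (Re_dir_dir_cplx w' sh Ox).
Qed.

End SecondOrder.

(** * Fields of type (1,0) tangent to the factors of a product *)

Section FieldCalculus.
Context {R : realType}.
Local Notation C := R[i].

Lemma smoothC_hol_part d (U : set 'rV[R]_d) (J : 'rV[R]_d -> 'M[R]_d) u a :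
  open U -> smooth_on U J -> smoothC U (fun x => hol_part (J x) u 0 a).
Proof.
move=> oU sJ; split.
  apply: (smooth_on_ext oU _ (smooth_on_cst U (u 0 a))) => x _.
  by rewrite !mxE /= mul0r mulr0 subr0 subr0.
have s1 : smooth_on U (fun x => - (\sum_b u 0 b * J x b a)).
  apply: smooth_onN => //; apply: smooth_on_sum => // b.
  apply: smooth_onM => //; [exact: smooth_on_cst|exact: smooth_on_mx_entry].
apply: (smooth_on_ext oU _ s1) => x _.
by rewrite !mxE /=; ring.
Qed.

Lemma smoothC_comp_lin d d' (L : {linear 'rV[R]_d -> 'rV[R]_d'})
  (U : set 'rV[R]_d') (h : 'rV[R]_d' -> C) : continuous L -> open U ->
  smoothC U h -> smoothC (L @^-1` U) (fun x => h (L x)).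
Proof.
move=> cL oU [hr hi]; split.
  exact: (smooth_on_comp_lin (f := fun x => complex.Re (h x))).
exact: (smooth_on_comp_lin (f := fun x => complex.Im (h x))).
Qed.

Section OnProduct.
Context {p q : nat}.
Local Notation T := 'rV[R]_(p + q).

Lemma rsubmx_basis_lshift (a : 'I_p) : rsubmx (basis_vec (R := R) (lshift q a)) = 0.
Proof. by apply/rowP => b; rewrite !mxE eq_sym eq_lrshift andbF. Qed.

Lemma lsubmx_basis_rshift (a : 'I_q) : lsubmx (basis_vec (R := R) (rshift p a)) = 0.
Proof. by apply/rowP => b; rewrite !mxE eq_lrshift andbF. Qed.

Lemma dir_invariant_l (h : T -> C) (v : 'rV[C]_(p + q)) x :
  (forall y z, rsubmx y = rsubmx z -> h y = h z) -> rsubmx v = 0 ->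
  dir v h x = 0.
Proof.
move=> H v0; rewrite /dir big_split_ord /= [X in _ + X]big1 ?addr0; last first.
  by move=> b _; move/rowP: v0 => /(_ b); rewrite !mxE => ->; rewrite mul0r.
rewrite big1 // => a _; suff -> : pd (lshift q a) h x = 0 by rewrite mulr0.
have E t : h (t *: basis_vec (lshift q a) + x) = h x.
  by apply: H; rewrite linearD linearZ /= rsubmx_basis_lshift scaler0 add0r.
by rewrite /pd !derive_invariant // => t; rewrite E.
Qed.

Lemma dir_invariant_r (h : T -> C) (v : 'rV[C]_(p + q)) x :
  (forall y z, lsubmx y = lsubmx z -> h y = h z) -> lsubmx v = 0 ->
  dir v h x = 0.
Proof.
move=> H v0; rewrite /dir big_split_ord /= big1 ?add0r; last first.
  by move=> b _; move/rowP: v0 => /(_ b); rewrite !mxE => ->; rewrite mul0r.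
rewrite big1 // => a _; suff -> : pd (rshift p a) h x = 0 by rewrite mulr0.
have E t : h (t *: basis_vec (rshift p a) + x) = h x.
  by apply: H; rewrite linearD linearZ /= lsubmx_basis_rshift scaler0 add0r.
by rewrite /pd !derive_invariant // => t; rewrite E.
Qed.

End OnProduct.

End FieldCalculus.

Section ProductPoint.
Context {R : realType} {m n : nat}.
Local Notation C := R[i].
Variables (X : @charted_space R m) (Y : @charted_space R n).
Variables (JX : mx_field X) (JY : mx_field Y).
Hypotheses (hX : smooth_manifold X) (hY : smooth_manifold Y).
Hypotheses (hJX : almost_complex JX) (hJY : almost_complex JY).
Local Notation XY := (prod_space X Y).
Local Notation J := (prod_acs JX JY).
Local Notation T := 'rV[R]_(m + n).

Lemma prod_acs_sqr (c : chart_index XY) (z : T) : cimg c z ->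
  J c z *m J c z = - 1%:M.
Proof.
case: c => c1 c2 [/= z1 z2]; rewrite /prod_acs /= mulmx_block.
rewrite !mulmx0 !mul0mx !addr0 !add0r.
have [_ -> //] := hJX; have [_ -> //] := hJY.
by rewrite -(oppr0 ('M[R]_(m, n))) -[in X in block_mx _ _ X](oppr0 ('M[R]_(n, m)))
  -opp_block_mx -scalar_mx_block.
Qed.

Definition fieldX (c : chart_index XY) (u : 'rV[R]_m) (z : T) : 'rV[C]_(m + n) :=
  hol_part (J c z) (row_mx u 0).
Definition fieldY (c : chart_index XY) (w : 'rV[R]_n) (z : T) : 'rV[C]_(m + n) :=
  hol_part (J c z) (row_mx 0 w).

Lemma fieldXE c u z : fieldX c u z = row_mx (hol_part (JX c.1 (lsubmx z)) u) 0.
Proof. exact: hol_part_blockl. Qed.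
Lemma fieldYE c w z : fieldY c w z = row_mx 0 (hol_part (JY c.2 (rsubmx z)) w).
Proof. exact: hol_part_blockr. Qed.

Variables (c : chart_index XY) (O : set T).
Hypotheses (oO : open O) (OC : O `<=` cimg c).

Lemma smooth_fieldX u a : smoothC O (fun z => fieldX c u z 0 a).
Proof.
have oU : open (cimg c.1) by case: hX => _ _ /(_ c.1)[[]].
case: (split_ordP a) => b ->.
  have s1 : smoothC (cimg c.1) (fun x => hol_part (JX c.1 x) u 0 b).
    by apply: smoothC_hol_part => //; case: hJX.
  have cl : continuous (@lsubmx R 1 m n).
    by move=> z; apply: differentiable_continuous; exact: differentiable_lsubmx.
  have s2 := smoothC_comp_lin cl oU s1.
  apply: (smoothC_ext oO _ (smoothC_sub _ s2)) => [z _|z /OC[]//].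
  by rewrite fieldXE row_mxEl.
apply: (smoothC_ext oO _ (smoothC_cst O 0)) => z _.
by rewrite fieldXE row_mxEr mxE.
Qed.

Lemma smooth_fieldY w a : smoothC O (fun z => fieldY c w z 0 a).
Proof.
have oU : open (cimg c.2) by case: hY => _ _ /(_ c.2)[[]].
case: (split_ordP a) => b ->.
  apply: (smoothC_ext oO _ (smoothC_cst O 0)) => z _.
  by rewrite fieldYE row_mxEl mxE.
have s1 : smoothC (cimg c.2) (fun x => hol_part (JY c.2 x) w 0 b).
  by apply: smoothC_hol_part => //; case: hJY.
have cl : continuous (@rsubmx R 1 m n).
  by move=> z; apply: differentiable_continuous; exact: differentiable_rsubmx.
have s2 := smoothC_comp_lin cl oU s1.
apply: (smoothC_ext oO _ (smoothC_sub _ s2)) => [z _|z /OC[]//].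
by rewrite fieldYE row_mxEr.
Qed.

(** Each field depends only on the coordinates of its own factor, and is tangent
    to that factor. *)
Lemma bracket_fieldX_fieldY u w z :
  bracket (fieldX c u) (fun y => conj_mx (fieldY c w y)) z = 0.
Proof.
have dX a : dir (fieldX c u z) (fun y => conj_mx (fieldY c w y) 0 a) z = 0.
  apply: dir_invariant_l; last by rewrite fieldXE row_mxKr.
  by move=> y y' E; rewrite !fieldYE E.
have dY a : dir (conj_mx (fieldY c w z)) (fun y => fieldX c u y 0 a) z = 0.
  apply: dir_invariant_r; first by move=> y y' E; rewrite !fieldXE E.
  by rewrite fieldYE /conj_mx map_row_mx row_mxKl map_mx0.
by apply/rowP => a; rewrite mxE dX dY subr0 mxE.
Qed.

(** The bracket itself need not vanish, because the almost complex structure of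
    the second factor varies. *)
Lemma bracket_fieldY_tangent w z :
  lsubmx (bracket (fieldY c w) (fun y => conj_mx (fieldY c w y)) z) = 0.
Proof.
apply/rowP => a; rewrite !mxE.
have E1 y : conj_mx (fieldY c w y) 0 (lshift n a) = 0.
  by rewrite mxE fieldYE row_mxEl mxE /= oppr0.
have E2 y : fieldY c w y 0 (lshift n a) = 0 by rewrite fieldYE row_mxEl mxE.
rewrite (_ : (fun y => conj_mx (fieldY c w y) 0 (lshift n a)) = fun=> 0); last exact/funext.
rewrite (_ : (fun y => fieldY c w y 0 (lshift n a)) = fun=> 0); last exact/funext.
by rewrite !dir_cst subr0.
Qed.

Variables (g : mx_field XY) (D : christoffel XY) (F : frame_data (R := R) (n := m + n)).
Hypothesis hg : riemannian_metric g.
Hypothesis hD : canonical_connection J g D.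
Hypothesis uF : unitary_frame_on J g D c O F.

Variables (z0 : T) (u : 'rV[R]_m) (w : 'rV[R]_n).
Hypothesis Oz0 : O z0.

Definition sqnorm_fieldX (z : T) : R := complex.Re (normsq (g c z) (fieldX c u z)).

Let s i y := ev1 (coframe F i y) (fieldX c u y).

Let ss i : smoothC O (s i).
Proof.
apply: smoothC_ev1 => //; last exact: smooth_fieldX.
by case: uF => _ [_ [H _]].
Qed.

Let tX v z : O z -> type10 (J c z) (fieldX c v z).
Proof. by move=> Oz; apply: hol_part_type10; exact/prod_acs_sqr/OC. Qed.
Let tY v z : O z -> type10 (J c z) (fieldY c v z).
Proof. by move=> Oz; apply: hol_part_type10; exact/prod_acs_sqr/OC. Qed.

Let hermE z : O z -> normsq (g c z) (fieldX c u z) = herm s s z.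
Proof.
move=> Oz; rewrite (normsq_frame uF Oz) //; last exact: tX.
exact/prod_acs_sqr/OC.
Qed.

Let herm_real z : complex.Im (herm s s z) = 0.
Proof. by rewrite /herm Im_sum big1 // => i _; exact: Im_mul_conj. Qed.

Let sherm : smoothC O (herm s s).
Proof. by apply: smoothC_sum => // i; apply: smoothCM => //; exact: smoothC_conj. Qed.

(** The mechanism of the whole proof: a (1,0)-field tangent to the first factor
    commutes with the (0,1)-fields tangent to the second one, hence has zero
    covariant derivative along them. *)
Let hol v z i : O z -> cov (conn_form F) s (conj_mx (fieldY c v z)) i z = 0.
Proof.
move=> Oz; apply: (torsion_hol uF (P := fieldX c u) (Q := fieldY c v)) => //.
- by move=> x; exact: prod_acs_sqr.
- by move=> x j Ox; case: hD => _ _ _ /(_ c O F uF x j Ox).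
- exact: smooth_fieldX.
- exact: smooth_fieldY.
- by move=> x Ox; exact: tX.
- by move=> x Ox; exact: tY.
- by move=> x _; exact: bracket_fieldX_fieldY.
Qed.

(** Being a matter of one point, the same holds for every (0,1)-vector tangent to
    the second factor. *)
Let hol01 v z i : O z -> type01 (J c z) v -> lsubmx v = 0 ->
  cov (conn_form F) s v i z = 0.
Proof.
move=> Oz tv v0; rewrite (type01_hol_part tv).
have -> : re_mx v = row_mx 0 (rsubmx (re_mx v)).
  rewrite -[LHS]hsubmxK re_mx_lsub v0; congr row_mx.
  by apply/rowP => a; rewrite !mxE.
exact: hol.
Qed.

Let skew y i j v : O y ->
  ev1 (conn_form F i j y) v + conjc (ev1 (conn_form F j i y) (conj_mx v)) = 0.
Proof.
case: hD => _ _ pg _ Oy; apply: (conn_skew uF _ pg) => //.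
by case: hg.
Qed.

Hypothesis slice_max : forall v : 'rV[R]_n, exists2 d : R, 0 < d &
  forall t : R, `|t| < d -> O (t *: row_mx 0 v + z0) /\
    sqnorm_fieldX (t *: row_mx 0 v + z0) <= sqnorm_fieldX z0.

Let max_line (v : 'rV[R]_n) :
  ('D_(row_mx 0 v) (fun y => complex.Re (herm s s y)) z0 : R) = 0 /\
  ('D_(row_mx 0 v) ('D_(row_mx 0 v) (fun y => complex.Re (herm s s y))) z0 : R) <= 0.
Proof.
have [d d0 H] := slice_max v.
apply: (@local_max_line _ _ O _ _ _ d oO sherm.1 Oz0 d0) => t td.
  by have [] := H t td.
have [Ot] := H t td.
by rewrite /sqnorm_fieldX !hermE.
Qed.

Let crit_r b : pd (rshift m b) (herm s s) z0 = 0.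
Proof.
have E : basis_vec (R := R) (rshift m b) = row_mx 0 (basis_vec b).
  apply/rowP => a; case: (split_ordP a) => k ->.
    by rewrite row_mxEl !mxE eq_lrshift andbF.
  by rewrite row_mxEr !mxE eq_rshift.
rewrite /pd E (max_line _).1.
by rewrite (derive_eq_on _ oO (g := fun=> 0)) ?derive_cst.
Qed.

Let crit v : lsubmx v = 0 -> dir v (herm s s) z0 = 0.
Proof.
move=> v0; rewrite /dir big_split_ord /= !big1 ?addr0 // => b _.
  by rewrite crit_r mulr0.
by move/rowP: v0 => /(_ b); rewrite !mxE => ->; rewrite mul0r.
Qed.

Hypothesis neg : bisectional J g c F z0 (fieldX c u z0) (fieldY c w z0) < 0.

(** At the maximum the Levi form of [|V|^2], where [V = fieldX c u], is nonpositive
    along [Q = fieldY c w]; by [bochner] it is a square minus the curvature term,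
    and a negative bisectional curvature makes it positive. *)
Lemma bisectional_not_negative_at_slice_max : False.
Proof.
pose Q := fieldY c w; pose Z := bracket Q (fun y => conj_mx (Q y)) z0.
have Z0 : lsubmx Z = 0 by exact: bracket_fieldY_tangent.
have JJ : J c z0 *m J c z0 = - 1%:M by exact/prod_acs_sqr/OC.
have [ZE t10 t01] := type_split Z JJ.
(* both type projections preserve tangency to the second factor *)
have lsub_proj (v : 'rV[C]_(m + n)) : lsubmx v = 0 -> lsubmx (v *m proj10 (J c z0)) = 0 /\
    lsubmx (v *m proj01 (J c z0)) = 0.
  move=> v0; have vJ : lsubmx (v *m cplx_mx (J c z0)) = 0.
    rewrite -[v]hsubmxK v0 /prod_acs /cplx_mx map_block_mx !map_mx0.
    by rewrite mul_row_block !mul0mx !mulmx0 addr0 row_mxKl.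
  rewrite /proj10 /proj01 -!scalemxAr mulmxBr mulmxDr !mulmx1 -!scalemxAr.
  have e0 k : v 0 (lshift n k) = 0 by move/rowP: v0 => /(_ k); rewrite !mxE.
  have e1 k : (v *m cplx_mx (J c z0)) 0 (lshift n k) = 0.
    by move/rowP: vJ => /(_ k); rewrite mxE => ->; rewrite mxE.
  move: (v *m _) e1 => vj e1.
  by split; apply/rowP => k; rewrite !mxE e0 e1 !(mulr0, oppr0, addr0).
have [Z10 Z01] := lsub_proj Z Z0.
have lsub_conj (v : 'rV[C]_(m + n)) : lsubmx v = 0 -> lsubmx (conj_mx v) = 0 :> 'rV[C]_m.
  move=> v0; apply/rowP => a; move/rowP: v0 => /(_ a); rewrite !mxE => ->.
  by rewrite /= oppr0.
have B := bochner oO (fun i j => let: conj _ (conj _ H) :=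
   (let: And5 _ H _ _ _ := uF in H) in H i j) ss (smooth_fieldY w) Oz0
   skew (fun y i => @hol w y i) ZE (fun i => hol01 i Oz0 t01 Z01)
   (fun i => hol01 i Oz0 (type10_conj t10) (lsub_conj _ Z10))
   (crit (lsub_conj _ Z10)).
have L : complex.Re (dir (Q z0) (fun y => dir (conj_mx (Q y)) (herm s s) y) z0) <= 0.
  have w'E : row_mx 0 w *m J c z0 = row_mx 0 (w *m JY c.2 (rsubmx z0)).
    by rewrite /prod_acs mul_row_block !mul0mx !mulmx0 !add0r.
  apply: (levi_nonpos oO sherm (w := row_mx 0 w)
    (w' := row_mx 0 (w *m JY c.2 (rsubmx z0)))) => //.
  - exact: smooth_fieldY.
  - by rewrite -w'E.
  - exact: (max_line _).2.
  - exact: (max_line _).2.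
  - move=> a; case: (split_ordP a) => b ->; last by rewrite crit_r mulr0.
    rewrite (_ : (fun y => conj_mx (Q y) 0 (lshift n b)) = fun=> 0).
      by rewrite dir_cst mul0r.
    apply/funext => y.
    by rewrite mxE /Q fieldYE row_mxEl mxE /= oppr0.
have N10 : 0 <= normsq (g c z0) (fieldX c u z0).
  rewrite (normsq_frame uF Oz0 JJ (tX u Oz0)).
  by apply: sumr_ge0 => i _; exact: mul_conj_ge0.
have N20 : 0 <= normsq (g c z0) (Q z0).
  rewrite (normsq_frame uF Oz0 JJ (tY w Oz0)).
  by apply: sumr_ge0 => i _; exact: mul_conj_ge0.
pose S := \sum_i \sum_j ev2 (curv (conn_form F) i j z0) (Q z0) (conj_mx (Q z0)) *
  s i z0 * conjc (s j z0).
have SE : bisectional J g c F z0 (fieldX c u z0) (Q z0) =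
    S / (normsq (g c z0) (fieldX c u z0) * normsq (g c z0) (Q z0)).
  exact: (bisectional_numerator uF Oz0 JJ (tX u Oz0) (tY w Oz0)).
have S0 : S < 0.
  move: neg; rewrite SE => num.
  exact: (lt0_of_div_lt0 N10 N20 num).
move: L; rewrite B -[\sum_i \sum_j _]/S.
set A := (\sum_i _ * _) => L.
have A0 : 0 <= A by apply: sumr_ge0 => i _; exact: mul_conj_ge0.
by have := Re_sub_conj_gt0 A0 S0; rewrite ltNge L.
Qed.

End ProductPoint.

(** * Maximum of the norm over a slice *)

Section RowMx.
Context {R : realType} {m n : nat}.

Lemma continuous_row_mxr (a : 'rV[R]_m) :
  continuous (fun y : 'rV[R]_n => row_mx a y).
Proof.
move=> u A /nbhs_ballP[e /= e0 eA].
apply/nbhs_ballP; exists e => //= v [_ uv]; apply: eA; split => // i j.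
case: (split_ordP j) => k ->; first by rewrite !row_mxEl; exact: ballxx.
by rewrite !row_mxEr; exact: uv.
Qed.

Lemma continuous_row_mxl (a : 'rV[R]_n) :
  continuous (fun y : 'rV[R]_m => row_mx y a).
Proof.
move=> u A /nbhs_ballP[e /= e0 eA].
apply/nbhs_ballP; exists e => //= v [_ uv]; apply: eA; split => // i j.
case: (split_ordP j) => k ->; last by rewrite !row_mxEr; exact: ballxx.
by rewrite !row_mxEl; exact: uv.
Qed.

Lemma differentiable_row_mx (V : normedModType R) (f : V -> 'rV[R]_m)
    (h : V -> 'rV[R]_n) x :
  differentiable f x -> differentiable h x ->
  differentiable (fun z => row_mx (f z) (h z)) x.
Proof.
move=> df dh.
have linl : linear (fun y : 'rV[R]_m => row_mx y (0 : 'rV[R]_n)).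
  by move=> k u v; rewrite scale_row_mx add_row_mx scaler0 addr0.
have linr : linear (fun y : 'rV[R]_n => row_mx (0 : 'rV[R]_m) y).
  by move=> k u v; rewrite scale_row_mx add_row_mx scaler0 addr0.
pose Ll : {linear 'rV[R]_m -> 'rV[R]_(m + n)} := HB.pack
  (fun y : 'rV[R]_m => row_mx y (0 : 'rV[R]_n)) (GRing.isLinear.Build _ _ _ _ _ linl).
pose Lr : {linear 'rV[R]_n -> 'rV[R]_(m + n)} := HB.pack
  (fun y : 'rV[R]_n => row_mx (0 : 'rV[R]_m) y) (GRing.isLinear.Build _ _ _ _ _ linr).
have cl : continuous Ll by exact: continuous_row_mxl.
have cr : continuous Lr by exact: continuous_row_mxr.
rewrite (_ : (fun z => _) = (Ll \o f) + (Lr \o h)); last first.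
  by apply/funext => z; rewrite fctE /= add_row_mx addr0 add0r.
apply: differentiableD; apply: differentiable_comp => //;
  exact: linear_differentiable.
Qed.

End RowMx.

Section Slice.
Context {R : realType} {m n : nat}.
Local Notation C := R[i].
Variables (X : @charted_space R m) (Y : @charted_space R n).
Variables (JX : mx_field X) (JY : mx_field Y).
Hypotheses (hX : smooth_manifold X) (hY : smooth_manifold Y).
Local Notation XY := (prod_space X Y).
Local Notation T := 'rV[R]_(m + n).
Variable g : mx_field XY.
Hypothesis hg : riemannian_metric g.
Variables (c1 : chart_index X) (x0 : X) (u : 'rV[R]_m).
Hypothesis x0c : chart_dom (atlas c1) x0.

Local Notation a := (chart_map (atlas c1) x0).

Let chX c : is_chart (atlas (c : chart_index X)). Proof. by case: hX. Qed.
Let chY c : is_chart (atlas (c : chart_index Y)). Proof. by case: hY. Qed.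

Definition slice_point (d : chart_index Y) (p : Y) : T :=
  row_mx a (chart_map (atlas d) p).

Let transE d d' (z : T) : cimg c1 (lsubmx z) ->
  transition (M := XY) (c1, d) (c1, d') z =
  row_mx (lsubmx z) (transition d d' (rsubmx z)).
Proof. by move=> Iz; rewrite /transition /= (proj2 (let: And5 _ _ H _ _ := chX c1 in H)). Qed.

Let slice_cimg d p : chart_dom (atlas d) p -> cimg (M := XY) (c1, d) (slice_point d p).
Proof.
move=> pd; rewrite /slice_point /cimg /= row_mxKl row_mxKr.
have [_ [H _] _ _ _] := chX c1; have [_ [H' _] _ _ _] := chY d.
by split; [exact: H|exact: H'].
Qed.

Let slice_overlap d d' p : chart_dom (atlas d) p -> chart_dom (atlas d') p ->
  overlap (M := XY) (c1, d) (c1, d') (slice_point d p).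
Proof.
move=> pd pd'; split; first exact: slice_cimg.
rewrite /slice_point /= row_mxKl row_mxKr.
have [_ _ [H _] _ _] := chX c1; have [_ _ [H' _] _ _] := chY d.
by rewrite H // H'.
Qed.

Let slice_transition d d' p : chart_dom (atlas d) p ->
  transition (M := XY) (c1, d) (c1, d') (slice_point d p) = slice_point d' p.
Proof.
move=> pd; have [Il _] := slice_cimg pd.
rewrite transE // /slice_point row_mxKl row_mxKr /transition.
by have [_ _ [H' _] _ _] := chY d; rewrite H'.
Qed.

(** A change of chart of the second factor leaves the coordinates of the first one
    unchanged, so that its Jacobian fixes the vectors tangent to the first factor. *)
Lemma slice_tjac d d' p (v : 'rV[R]_m) :
  chart_dom (atlas d) p -> chart_dom (atlas d') p ->
  row_mx v 0 *m tjac (M := XY) (c1, d) (c1, d') (slice_point d p) = row_mx v 0.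
Proof.
move=> pd pd'; set z := slice_point d p.
have [[Il Ir] _] := slice_overlap pd pd'.
have oC : open (cimg c1) by case: (chX c1) => -[].
have near_l : \near z, cimg c1 (lsubmx z).
  have := @continuous_lsubmx R 1 m n z; apply.
  exact: (open_near oC Il).
pose G (y : T) := row_mx (lsubmx y) (transition d d' (rsubmx y)).
have GE : \near z, G z = transition (M := XY) (c1, d) (c1, d') z.
  by apply: filterS near_l => y Iy; rewrite transE.
have dG : differentiable G z.
  apply: differentiable_row_mx; first exact: differentiable_lsubmx.
  apply: (@differentiable_comp _ _ _ _ rsubmx (transition d d')).
    exact: differentiable_rsubmx.
  have [_ _ _ _ /(_ d d') st] := hY.
  apply: (smooth_on_differentiable st); rewrite /z /slice_point row_mxKr.
  split; first by move: Ir; rewrite /z /slice_point row_mxKr.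
  by have [_ _ [H' _] _ _] := chY d; rewrite H'.
have dt := near_eq_differentiable GE dG.
rewrite /tjac -deriveEjacobian // -(near_eq_derive _ GE).
rewrite /derive; apply: cvg_lim => //.
apply: (@cvg_trans _ ((fun=> row_mx v 0 : T) @ (0 : R)^')); last exact: cvg_cst.
apply: near_eq_cvg; near=> t.
have t0 : t != 0 by near: t; exact: nbhs_dnbhs_neq.
have lE : lsubmx (t *: row_mx v 0 + z) = t *: v + lsubmx z.
  by rewrite linearD linearZ /= row_mxKl.
have rE : rsubmx (t *: row_mx v 0 + z) = rsubmx z.
  by rewrite linearD linearZ /= row_mxKr scaler0 add0r.
rewrite /G /= lE rE.
rewrite opp_row_mx add_row_mx subrr addrK scale_row_mx scaler0 scalerA.
by rewrite mulVf // scale1r.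
Unshelve. all: by end_near. Qed.

(** The square norm at [(x0, p)] of the fixed (1,0)-vector tangent to the first
    factor, computed in the chart [d] around [p]; by [slice_norm_chart] it is a
    function of [p] alone. *)
Definition slice_norm (d : chart_index Y) (p : Y) : R :=
  sqnorm_fieldX JX JY (c1, d) g u (slice_point d p).

Lemma slice_norm_chart d d' p : chart_dom (atlas d) p -> chart_dom (atlas d') p ->
  slice_norm d p = slice_norm d' p.
Proof.
move=> pd pd'; apply: (congr1 (@complex.Re R)).
have lE e : lsubmx (slice_point e p) = a by rewrite /slice_point row_mxKl.
rewrite !fieldXE !lE /=.
set V := hol_part _ _; pose W : 'rV[C]_(m + n) := row_mx V 0.
have [_ _ _ /(_ (c1, d) (c1, d') (slice_point d p))] := hg.
move=> /(_ (slice_overlap pd pd')); rewrite slice_transition // => ->.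
set Tj := tjac _ _ _.
have WT : W *m cplx_mx Tj = W.
  rewrite (cplx_reim W) mulmxDl -scalemxAl -!cplx_mxM.
  have -> : re_mx W = row_mx (re_mx V) 0 by rewrite /re_mx map_row_mx map_mx0.
  have -> : im_mx W = row_mx (im_mx V) 0 by rewrite /im_mx map_row_mx map_mx0.
  by rewrite !slice_tjac.
rewrite /normsq /metricC /ev2 !cplx_mxM.
have -> : cplx_mx Tj^T = (cplx_mx Tj)^T by apply/matrixP => i j; rewrite !mxE.
rewrite !mulmxA WT -[_ *m (cplx_mx Tj)^T *m _]mulmxA -trmx_mul.
by rewrite -(conj_cplx_mx Tj) -conj_mxM WT.
Qed.

Lemma slice_norm_continuous d p : chart_dom (atlas d) p ->
  {for p, continuous (slice_norm d)}.
Proof.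
move=> pd.
pose V : 'rV[C]_(m + n) := row_mx (hol_part (JX c1 a) u) 0.
pose N (z : T) : R := complex.Re (normsq (g (c1, d) z) V).
have NE q : slice_norm d q = N (slice_point d q).
  by rewrite /slice_norm /sqnorm_fieldX fieldXE /slice_point row_mxKl.
have oI : open (cimg (M := XY) (c1, d)).
  have [[_ o1] _ _ _ _] := chX c1; have [[_ o2] _ _ _ _] := chY d.
  apply: openI; apply: open_comp => // z _; 
    [exact: continuous_lsubmx|exact: continuous_rsubmx].
have sN : smoothC (cimg (M := XY) (c1, d)) (fun z => normsq (g (c1, d) z) V).
  apply: (smoothC_ext oI (h := fun z => \sum_i \sum_j
    V 0 i * conj_mx V 0 j * ((g (c1, d) z i j)%:C)%C)).
    move=> z _; rewrite /normsq /metricC ev2E.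
    by apply: eq_bigr => i _; apply: eq_bigr => j _; rewrite [cplx_mx _ _ _]mxE.
  apply: (smoothC_sum oI) => i; apply: (smoothC_sum oI) => j.
  apply: (smoothCM oI); first exact: smoothC_cst.
  split; last exact: smooth_on_cst.
  by apply: smooth_on_mx_entry => //; case: hg.
have cN : {for slice_point d p, continuous N}.
  apply: differentiable_continuous; apply: (smooth_on_differentiable sN.1).
  exact: slice_cimg.
rewrite (_ : slice_norm d = N \o slice_point d); last exact/funext.
apply: continuous_comp cN.
apply: (@continuous_comp _ _ _ (chart_map (atlas d)) (row_mx a)).
  by have [_ _ _ H _] := chY d; exact: H.
exact: continuous_row_mxr.
Qed.

(** Compactness of the second factor, applied to the function on it obtained by
    choosing a chart around each point. *)
Lemma slice_norm_attains_max : compact [set: Y] -> [set: Y] !=set0 ->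
  exists d p, chart_dom (atlas d) p /\
    forall d' q, chart_dom (atlas d') q -> slice_norm d' q <= slice_norm d p.
Proof.
move=> cY Y0; have [_ _ _ cov_Y _] := hY.
have [ch chP] := choice cov_Y.
pose F q := slice_norm (ch q) q.
have cF : continuous F.
  move=> q; have cq := slice_norm_continuous (chP q).
  have oD : open (chart_dom (atlas (ch q))) by case: (chY (ch q)) => -[].
  suff : F y @[y --> q] --> F q by [].
  apply: cvg_trans cq; apply: near_eq_cvg.
  apply: filterS (open_nbhs_nbhs (conj oD (chP q))) => y yq.
  exact: slice_norm_chart.
have [p _ pmax] := compact_EVT_max Y0 cY (continuous_subspaceT cF).
exists (ch p), p; split; first exact: chP.
move=> d' q qd; have := pmax q; rewrite /F (slice_norm_chart (chP q) qd).
by apply; rewrite inE.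
Qed.

End Slice.

Theorem corollary1p2 (R : realType) (m n : nat)
  (X : @charted_space R m) (Y : @charted_space R n)
  (JX : mx_field X) (JY : mx_field Y)
  (hX : smooth_manifold X) (hY : smooth_manifold Y)
  (cX : compact [set: X]) (cY : compact [set: Y])
  (m_gt0 : (0 < m)%N) (n_gt0 : (0 < n)%N)
  (hJX : almost_complex JX) (hJY : almost_complex JY) :
  ~ exists g : mx_field (prod_space X Y),
      almost_hermitian_metric (prod_acs JX JY) g /\
      negative_bisectional (prod_acs JX JY) g.
Proof.
move=> [g [[hg _] [D hD neg]]].
have const1_neq0 k : (0 < k)%N -> const_mx 1 != 0 :> 'rV[R]_k.
  move=> k0; apply/eqP => /rowP/(_ (Ordinal k0)); rewrite !mxE => /eqP.
  by rewrite oner_eq0.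
pose u : 'rV[R]_m := const_mx 1; pose w : 'rV[R]_n := const_mx 1.
have u0 : u != 0 by exact: const1_neq0.
have w0 : w != 0 by exact: const1_neq0.
have [_ [[x0 _] _] _ covX _] := hX.
have [_ [Y0 _] _ _ _] := hY.
have [c1 x0c] := covX x0.
have [d [p [pd pmax]]] := slice_norm_attains_max JX JY hX hY hg u x0c cY Y0.
pose c : chart_index (prod_space X Y) := (c1, d).
pose z0 := slice_point c1 x0 d p.
have chX : is_chart (atlas c1) by case: hX.
have chY : is_chart (atlas d) by case: hY.
have Iz0 : cimg c z0.
  rewrite /cimg /= /z0 /slice_point row_mxKl row_mxKr.
  have [_ [H _] _ _ _] := chX; have [_ [H' _] _ _ _] := chY.
  by split; [exact: H|exact: H'].
have [U [F [Uz0 uF negF]]] := neg c z0 Iz0.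
have [[oU UC] _ _ _ _] := uF.
apply: (@bisectional_not_negative_at_slice_max _ _ _ X Y JX JY hX hY hJX hJY c U oU UC
  g D F hg hD uF z0 u w Uz0); last first.
  have JJ := prod_acs_sqr hJX hJY Iz0.
  apply: negF.
  - exact: hol_part_type10.
  - exact: hol_part_type10.
  - apply: hol_part_neq0; apply: contraNneq u0 => /(congr1 lsubmx).
    by rewrite row_mxKl => ->; apply/eqP/rowP => k; rewrite !mxE.
  - apply: hol_part_neq0; apply: contraNneq w0 => /(congr1 rsubmx).
    by rewrite row_mxKr => ->; apply/eqP/rowP => k; rewrite !mxE.
move=> v.
have cl : {for (0 : R), continuous (fun t : R => t *: (row_mx 0 v : 'rV[R]_(m + n)) + z0)}.
  apply: differentiable_continuous.
  apply: differentiableD; last exact: differentiable_cst.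
  by apply: differentiableZl.
have /nbhs_ballP[r /= r0 Hr] : nbhs (0 : R)
    [set t : R | U (t *: (row_mx 0 v : 'rV[R]_(m + n)) + z0)].
  apply: (cl U); rewrite scale0r add0r; exact: (open_near oU Uz0).
exists r; first exact: r0.
move=> t tr.
have Ut : U (t *: row_mx 0 v + z0).
  by apply: Hr; rewrite /ball /= sub0r normrN.
split; first exact: Ut.
have [_ It2] := UC _ Ut.
pose y := rsubmx (t *: row_mx 0 v + z0).
have [_ [_ H1] [_ H2] _ _] := chY.
have -> : t *: row_mx 0 v + z0 = slice_point c1 x0 d (chart_inv (atlas d) y).
  rewrite /slice_point H2 // -[LHS]hsubmxK; congr row_mx.
  by rewrite linearD linearZ /= row_mxKl scaler0 add0r /z0 /slice_point row_mxKl.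
exact: pmax (H1 _ It2).
Qed.
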